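(* Suppose $\Omega\subset\mathbb{R}^n$ is a bounded quasihyperbolically well behaved domain and $\Omega'\subset\mathbb{R}^n$ is a bounded QH-visibility domain. Then every quasihyperbolic isometry $f:(\Omega,k_\Omega)\to(\Omega',k_{\Omega'})$ extends to a continuous map $F:\overline{\Omega}^{Euc}\to\overline{\Omega'}^{Euc}$.
   Context: For a domain $\Omega\subsetneq\mathbb{R}^n$, $\partial_{Euc}\Omega$ and $\overline{\Omega}^{Euc}$ are its Euclidean boundary and closure, and $\delta_\Omega(x)=d_{Euc}(x,\partial_{Euc}\Omega)$. The quasihyperbolic metric is $k_\Omega(x,y)=\inf_\gamma\int_\gamma\frac{|dx|}{\delta_\Omega(x)}$, the infimum over rectifiable curves in $\Omega$ joining $x$ and $y$; $(\Omega,k_\Omega)$ is a complete, proper, geodesic metric space, and a quasihyperbolic geodesic is a geodesic of $(\Omega,k_\Omega)$. For a curve $\gamma$, $k_\Omega(x_0,\gamma)$ denotes the $k_\Omega$-distance from $x_0$ to the image of $\gamma$. An isometry is a distance-preserving map (isometry onto its range). A bounded domain $\Omega\subset\mathbb{R}^n$ is quasihyperbolically well behaved if, whenever $\{x_k\},\{y_k\}$ are sequences in $\Omega$ with $\lim_{k}x_k=\lim_k y_k=p\in\partial_{Euc}\Omega$ and $\gamma_k:[a_k,b_k]\to\Omega$ is a sequence of quasihyperbolic geodesics joining $x_k$ and $y_k$, one has $\lim_{k\to\infty}k_\Omega(x_0,\gamma_k)=\infty$ for some (hence all) $x_0\in\Omega$. A bounded domain $\Omega$ is a QH-visibility domain if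 for every pair $p,q\in\partial_{Euc}\Omega$, $p\neq q$, there exist neighborhoods $U$ of $p$ and $V$ of $q$ in $\mathbb{R}^n$ with $\overline U\cap\overline V=\emptyset$ and a compact set $K\subset\Omega$ such that every quasihyperbolic geodesic $\gamma:[0,T]\to\Omega$ with $\gamma(0)\in U$ and $\gamma(T)\in V$ satisfies $\gamma([0,T])\cap K\neq\emptyset$. *)

(* Defs.v *)
From HB Require Import structures.
From mathcomp Require Import all_boot all_order all_algebra.
From mathcomp Require Import all_classical all_reals all_analysis.

Set Implicit Arguments.
Unset Strict Implicit.
Unset Printing Implicit Defensive.

Import Order.TTheory GRing.Theory Num.Theory.
Import numFieldNormedType.Exports.

Local Open Scope classical_set_scope.
Local Open Scope ring_scope.

(* R^n is 'rV[R]_n.  The library norm on matrices is the sup norm, so metric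
   notions (length, distance to the boundary) go through [enorm]; open, closed,
   compact, bounded sets and limits are the same for the two norms. *)
Definition enorm (R : realType) (n : nat) (x : 'rV[R]_n) : R :=
  Num.sqrt (\sum_(i < n) x 0 i ^+ 2).

Definition boundary (T : topologicalType) (A : set T) : set T :=
  closure A `\` A°.

(* The condition O <> setT is automatic for a bounded set when 0 < n; it makes
   the boundary nonempty in every dimension. *)
Definition bounded_domain (R : realType) (n : nat) (O : set 'rV[R]_n) : Prop :=
  [/\ O !=set0, open O, connected O, O <> setT & bounded_set O].

Definition bdist (R : realType) (n : nat) (O : set 'rV[R]_n) (x : 'rV[R]_n)
    : R :=
  inf [set enorm (x - z) | z in boundary O].

(* Vector-valued analogue of [variation]: the length of the polygon through the
   images of the subdivision points a :: s. *)
Definition polygonal_length (R : realType) (n : nat) (g : R -> 'rV[R]_n)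
    (a b : R) (s : seq R) : R :=
  let G := g \o nth b (a :: s) in
  \sum_(0 <= i < size s) enorm (G i.+1 - G i).

Definition curve_length (R : realType) (n : nat) (g : R -> 'rV[R]_n)
    (a b : R) : \bar R :=
  ereal_sup [set (polygonal_length g a b s)%:E | s in itv_partition a b].

Definition rectifiable_curve (R : realType) (n : nat) (g : R -> 'rV[R]_n)
    (a b : R) : Prop :=
  [/\ a <= b, {within `[a, b], continuous g} & (curve_length g a b < +oo)%E].

(* The point of the curve at arc length s from g a.  The parameter t need not
   be unique, but g is constant on each level set of the length function. *)
Definition arclength_param (R : realType) (n : nat) (g : R -> 'rV[R]_n)
    (a b s : R) : 'rV[R]_n :=
  g (xget a [set t | t \in `[a, b] /\ curve_length g a t = s%:E]).

(* The integral of rho |dx| over a rectifiable curve. *)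
Definition line_integral (R : realType) (n : nat) (rho : 'rV[R]_n -> R)
    (g : R -> 'rV[R]_n) (a b : R) : \bar R :=
  (\int[@lebesgue_measure R]_(s in `[0%R, fine (curve_length g a b)])
     (rho (arclength_param g a b s))%:E)%E.

Definition qh_dist (R : realType) (n : nat) (O : set 'rV[R]_n)
    (x y : 'rV[R]_n) : \bar R :=
  ereal_inf [set l | exists (g : R -> 'rV[R]_n) (a b : R),
    [/\ rectifiable_curve g a b, g @` `[a, b] `<=` O, g a = x, g b = y
      & l = line_integral (fun z => (bdist O z)^-1) g a b]].

Definition qh_geodesic (R : realType) (n : nat) (O : set 'rV[R]_n)
    (g : R -> 'rV[R]_n) (a b : R) : Prop :=
  [/\ a <= b, g @` `[a, b] `<=` O
    & forall s t, s \in `[a, b] -> t \in `[a, b] ->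
        qh_dist O (g s) (g t) = `|s - t|%:E].

Definition qh_dist_set (R : realType) (n : nat) (O : set 'rV[R]_n)
    (x : 'rV[R]_n) (A : set 'rV[R]_n) : \bar R :=
  ereal_inf [set qh_dist O x z | z in A].

Definition qh_well_behaved (R : realType) (n : nat) (O : set 'rV[R]_n)
    : Prop :=
  bounded_domain O /\
  forall (x y : nat -> 'rV[R]_n) (p : 'rV[R]_n) (a b : nat -> R)
      (g : nat -> R -> 'rV[R]_n),
    (forall k, O (x k)) -> (forall k, O (y k)) -> boundary O p ->
    x @ \oo --> p -> y @ \oo --> p ->
    (forall k, [/\ qh_geodesic O (g k) (a k) (b k),
                   g k (a k) = x k & g k (b k) = y k]) ->
    exists2 x0, O x0 &
      (fun k => qh_dist_set O x0 (g k @` `[a k, b k])) @ \oo --> +oo%E.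

Definition qh_visibility_domain (R : realType) (n : nat) (O : set 'rV[R]_n)
    : Prop :=
  bounded_domain O /\
  forall p q : 'rV[R]_n, boundary O p -> boundary O q -> p <> q ->
    exists U V K : set 'rV[R]_n,
      [/\ nbhs p U, nbhs q V, closure U `&` closure V = set0,
          compact K /\ K `<=` O
        & forall (T : R) (g : R -> 'rV[R]_n),
            qh_geodesic O g 0 T -> U (g 0) -> V (g T) ->
            (g @` `[0, T]) `&` K !=set0].

(* Only the values of f on O matter. *)
Definition qh_isometry (R : realType) (n : nat) (O O' : set 'rV[R]_n)
    (f : 'rV[R]_n -> 'rV[R]_n) : Prop :=
  f @` O `<=` O' /\
  forall x y, O x -> O y -> qh_dist O' (f x) (f y) = qh_dist O x y.

(* Main.v *)
Require Import Defs.
From HB Require Import structures.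
From mathcomp Require Import all_boot all_order all_algebra.
From mathcomp Require Import all_classical all_reals all_analysis.
From mathcomp Require Import lra ring.
Import Order.TTheory GRing.Theory Num.Theory.
Import numFieldNormedType.Exports.
Local Open Scope classical_set_scope.
Local Open Scope ring_scope.

Set Implicit Arguments.
Unset Strict Implicit.

(** Let p be a boundary point of O and let x_k, y_k be sequences of O that
    converge to p and whose images converge to xi and eta.  Quasihyperbolic
    geodesics g_k from x_k to y_k leave every quasihyperbolic ball, because O
    is well behaved; f sends them to geodesics of O' that leave every ball as
    well.  Quasihyperbolic distances are bounded near each point of O', so xi
    and eta are boundary points, and the geodesics f o g_k avoid any given
    compact subset of O' from some rank on.  If xi and eta were distinct, this
    would contradict visibility ([no_two_boundary_limits]).  Hence f has a limit
    at each boundary point ([qh_isometry_limit]), f is continuous on O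
    ([qh_isometry_continuous]), and the function of limits is continuous on the
    closure, as for any map with values in a metric space.

    The argument needs geodesics between any two points of O.  To obtain them
    from a distance that is an infimum of Lebesgue integrals along arc length
    parametrizations, all integrals are traded for a pointwise condition.  Write
    d for the distance to the boundary and call h, defined on [0, L],
    quasihyperbolically Lipschitz when
      |h t - h s| <= d (h s) (exp |t - s| - 1)  for all s and t,
    that is, when h does not increase distances for the metric
    log (1 + |x - y| / min (d x) (d y)).  Then the quasihyperbolic distance from
    x to y is the infimum of the L for which such an h joins x to y:
    - a curve of quasihyperbolic length L becomes such an h when it is
      parametrized by quasihyperbolic length, since d increases at most at unit
      speed along the curve, in both directions ([line_integral_joined]);
    - conversely h has quasihyperbolic length at most L ([qh_lipschitz_dist]).
    Both directions compare functions whose increments differ by a quadratic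
    error, and conclude by [quadratic_increments_le].

    The condition involves no integral and no derivative.  It passes to
    subintervals, reversed curves and concatenations, and it survives pointwise
    limits.  It also bounds d from below along h, so that nearly minimal curves
    from x to y stay in a compact part of O: Tychonoff's theorem gives a cluster
    point of these curves, and it is a geodesic ([qh_geodesic_exists]). *)

(** * The Euclidean norm *)

Section Enorm.
Context {R : realType} {n : nat}.
Implicit Types x y z : 'rV[R]_n.

Lemma enorm_ge0 x : 0 <= enorm x.
Proof. exact: sqrtr_ge0. Qed.

Lemma sqr_enorm x : enorm x ^+ 2 = \sum_(i < n) x 0 i ^+ 2.
Proof. by rewrite sqr_sqrtr // sumr_ge0 // => i _; exact: sqr_ge0. Qed.

Lemma enormZ (c : R) x : enorm (c *: x) = `|c| * enorm x.
Proof.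
rewrite /enorm -sqrtr_sqr -sqrtrM ?sqr_ge0 // mulr_sumr.
by congr Num.sqrt; apply: eq_bigr => i _; rewrite mxE exprMn.
Qed.

Lemma enorm0 : enorm (0 : 'rV[R]_n) = 0.
Proof. by rewrite -(scale0r (0 : 'rV[R]_n)) enormZ normr0 mul0r. Qed.

Lemma enormN x : enorm (- x) = enorm x.
Proof. by rewrite -scaleN1r enormZ normrN1 mul1r. Qed.

Lemma enorm_distC x y : enorm (x - y) = enorm (y - x).
Proof. by rewrite -enormN opprB. Qed.

Lemma coord_le_enorm x i : `|x 0 i| <= enorm x.
Proof.
rewrite -sqrtr_sqr ler_wsqrtr // (bigD1 i) //= lerDl sumr_ge0 // => j _.
exact: sqr_ge0.
Qed.

(** Cauchy-Schwarz: twice the difference of the two sides, multiplied by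
    [enorm x * enorm y], is a sum of squares. *)
Lemma dot_le_enorm x y : \sum_(i < n) x 0 i * y 0 i <= enorm x * enorm y.
Proof.
have [x0|x0] := eqVneq (enorm x) 0.
  rewrite x0 mul0r big1 // => i _.
  have := coord_le_enorm x i; rewrite x0 normr_le0 => /eqP ->.
  by rewrite mul0r.
have [y0|y0] := eqVneq (enorm y) 0.
  rewrite y0 mulr0 big1 // => i _.
  have := coord_le_enorm y i; rewrite y0 normr_le0 => /eqP ->.
  by rewrite mulr0.
have xy : 0 < enorm x * enorm y by rewrite mulr_gt0 // lt_def enorm_ge0 ?x0 ?y0.
rewrite -(ler_pM2l xy) -(ler_pM2l (ltr0Sn R 1)).
have -> : 2 * (enorm x * enorm y * (enorm x * enorm y)) =
    enorm y ^+ 2 * enorm x ^+ 2 + enorm x ^+ 2 * enorm y ^+ 2 by ring.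
rewrite {1}(sqr_enorm x) {2}(sqr_enorm y) !mulr_sumr -big_split /=.
apply: ler_sum => i _.
rewrite -subr_ge0.
have -> : enorm y ^+ 2 * x 0 i ^+ 2 + enorm x ^+ 2 * y 0 i ^+ 2 -
    2 * (enorm x * enorm y * (x 0 i * y 0 i)) =
    (enorm y * x 0 i - enorm x * y 0 i) ^+ 2 by ring.
exact: sqr_ge0.
Qed.

Lemma enorm_triangle x y : enorm (x + y) <= enorm x + enorm y.
Proof.
rewrite -(@ler_pXn2r _ 2) ?nnegrE ?addr_ge0 ?enorm_ge0 // sqrrD !sqr_enorm.
under eq_bigr do rewrite mxE sqrrD -mulr_natl.
rewrite !big_split /= -mulr_sumr mulr_natl lerD2r lerD2l lerMn2r /=.
exact: dot_le_enorm.
Qed.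

Lemma enorm_dist_triangle y x z : enorm (x - z) <= enorm (x - y) + enorm (y - z).
Proof. by rewrite -[x - z](subrKA y) enorm_triangle. Qed.

Lemma enorm_le_sum x : enorm x <= \sum_(i < n) `|x 0 i|.
Proof.
rewrite -(@ler_pXn2r _ 2) ?nnegrE ?enorm_ge0 ?sumr_ge0 // sqr_enorm.
rewrite expr2 mulr_suml; apply: ler_sum => i _.
rewrite -normr_id -real_normK ?num_real // expr2 normr_id ler_wpM2l //.
by rewrite (bigD1 i) //= lerDl sumr_ge0.
Qed.

Lemma norm_le_enorm x : `|x| <= enorm x.
Proof.
rewrite [leLHS]/Num.norm /= mx_normrE; apply: bigmax_le => [|[i j] _ /=].
  exact: enorm_ge0.
by rewrite ord1 coord_le_enorm.
Qed.

Lemma enorm_le_norm x : enorm x <= n%:R * `|x|.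
Proof.
apply: (le_trans (enorm_le_sum x)).
have -> : n%:R * `|x| = \sum_(i < n) `|x|.
  by rewrite sumr_const card_ord mulr_natl.
apply: ler_sum => i _; rewrite [leRHS]/Num.norm /= mx_normrE.
exact: (le_bigmax _ (fun ij : 'I_1 * 'I_n => `|x ij.1 ij.2|) (0, i)).
Qed.

Lemma enorm_eq0 x : enorm x = 0 -> x = 0.
Proof.
by move=> x0; apply/eqP; rewrite -normr_le0 -x0 norm_le_enorm.
Qed.

Lemma near_enorm_lt x (e : R) : 0 < e -> \forall y \near x, enorm (y - x) < e.
Proof.
move=> e0; near=> y; apply: (le_lt_trans (enorm_le_norm _)).
have : `|x - y| < e / n.+1%:R.
  by near: y; apply: cvgr_dist_lt => //; rewrite divr_gt0.
rewrite distrC ltr_pdivlMr // mulrC => /(le_lt_trans _); apply.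
by rewrite ler_wpM2r // ler_nat.
Unshelve. all: by end_near. Qed.

Lemma nbhs_enormP x (A : set 'rV[R]_n) :
  nbhs x A -> exists2 e, 0 < e & forall y, enorm (y - x) < e -> A y.
Proof.
move=> /nbhs_ballP [e /= e0 eA]; exists e => // y ye; apply: eA.
by rewrite -ball_normE /= distrC (le_lt_trans (norm_le_enorm _)).
Qed.

End Enorm.

(** * The distance to the boundary *)

Section BoundaryDistance.
Context {R : realType} {n : nat} (O : set 'rV[R]_n).
Hypothesis domO : bounded_domain O.
Implicit Types x y z : 'rV[R]_n.
Local Notation bd := (bdist O).

Let openO : open O. Proof. by case: domO. Qed.

Lemma domain_not_boundary z : O z -> ~ boundary O z.
Proof. by move=> Oz [_]; apply; move: openO; rewrite openE; exact. Qed.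

Lemma closure_domain_boundary z : closure O z -> ~ O z -> boundary O z.
Proof. by move=> cz nz; split => // iz; apply: nz; exact: interior_subset. Qed.

(** The first exit point from O of the segment from x to y is a limit of points
    of O and is not in the open set O. *)
Lemma segment_meets_boundary x y : O x -> ~ O y ->
  exists2 z, boundary O z & enorm (x - z) <= enorm (x - y).
Proof.
move=> Ox nOy.
pose p (t : R) := x + t *: (y - x).
have cp : continuous p.
  move=> t; apply: cvgD; first exact: cvg_cst.
  by apply: cvgZr_tmp; exact: cvg_id.
(* S is the set of times up to which the segment stays in O. *)
pose S := [set t : R | 0 <= t /\ forall s, 0 <= s <= t -> O (p s)].
have p0 : p 0 = x by rewrite /p scale0r addr0.
have p1 : p 1 = y by rewrite /p scale1r subrKC.
have S0 : S 0.
  by split => // s; rewrite -eq_le => /eqP <-; rewrite p0.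
have S1 t : S t -> t <= 1.
  move=> [t0 St]; rewrite leNgt; apply/negP => t1; apply: nOy.
  by rewrite -p1; apply: St; rewrite ler01 ltW.
have supS : has_sup S by split; [exists 0 | exists 1 => t; exact: S1].
pose m := sup S.
have m0 : 0 <= m by apply: sup_upper_bound.
have m1 : m <= 1 by apply: sup_le_ub => //; [exists 0].
have below s : 0 <= s -> s < m -> O (p s).
  move=> s0 sm; have := sup_adherent _ supS; rewrite -/m.
  move=> /(_ (m - s)) []; first by rewrite subr_gt0.
  move=> t [t0 St]; rewrite opprB subrKC => st; apply: St.
  by rewrite s0 ltW.
have nOm : ~ O (p m).
  move=> Om.
  have [e /= e0 em] : nbhs m [set t | O (p t)].
    by apply: cp; move: openO; rewrite openE; exact.
  have : S (m + e / 2).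
    split; first by rewrite addr_ge0 // divr_ge0 // ltW.
    move=> s /andP[s0 sm]; have [|ms] := ltP s m; first exact: below.
    by apply: em; rewrite /ball_ /= ler0_norm; lra.
  move=> /(sup_upper_bound supS); rewrite -/m; lra.
have {}m0 : 0 < m.
  by rewrite lt_def m0 andbT; apply/eqP => me; apply: nOm; rewrite me p0.
exists (p m).
  apply: closure_domain_boundary nOm => B /cp /nbhs_ballP [e /= e0 eB].
  pose s := Num.max 0 (m - e / 2).
  have s0 : 0 <= s by rewrite le_max lexx.
  have sm : s < m by rewrite gt_max m0 /=; lra.
  have se : m - e / 2 <= s by rewrite le_max lexx orbT.
  exists (p s); split; first exact: below.
  by apply: eB; rewrite /ball /= gtr0_norm ?subr_gt0; lra.
rewrite /p opprD addrA subrr add0r enormN enormZ [leRHS]enorm_distC.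
by rewrite gtr0_norm // ler_piMl // enorm_ge0.
Qed.

(** Without this, [bdist O] would be the infimum of the empty set. *)
Lemma boundary_nonempty : boundary O !=set0.
Proof.
case: domO => -[x Ox] _ _ OT _.
have [y nOy] : exists y, ~ O y.
  by apply/existsNP => H; apply: OT; rewrite -subTset => y _; exact: H.
by have [z bz _] := segment_meets_boundary Ox nOy; exists z.
Qed.

Let dists_inf x : has_inf [set enorm (x - z) | z in boundary O].
Proof.
split; last by exists 0 => _ [z _ <-]; exact: enorm_ge0.
by have [z bz] := boundary_nonempty; exists (enorm (x - z)); exists z.
Qed.

Lemma bdist_le x z : boundary O z -> bd x <= enorm (x - z).
Proof. by move=> bz; apply: ge_inf; [case: (dists_inf x) | exists z]. Qed.

Lemma le_bdist x c : (forall z, boundary O z -> c <= enorm (x - z)) -> c <= bd x.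
Proof.
move=> H; apply: lb_le_inf; first by case: (dists_inf x).
by move=> _ [z bz <-]; exact: H.
Qed.

Lemma bdist_ge0 x : 0 <= bd x.
Proof. by apply: le_bdist => z _; exact: enorm_ge0. Qed.

Lemma bdist_lip x y : bd y <= bd x + enorm (y - x).
Proof.
rewrite -lerBlDr; apply: le_bdist => z bz; rewrite lerBlDr addrC.
by rewrite (le_trans (bdist_le _ bz)) // enorm_dist_triangle.
Qed.

Lemma bdist_gt0 x : O x -> 0 < bd x.
Proof.
move=> Ox; have /nbhs_enormP [e e0 eO] : nbhs x O.
  by move: openO; rewrite openE; exact.
rewrite (lt_le_trans e0) //; apply: le_bdist => z bz; rewrite leNgt.
apply/negP; rewrite enorm_distC => /eO /domain_not_boundary; exact.
Qed.

Lemma bdist_ball x y : O x -> enorm (y - x) < bd x -> O y.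
Proof.
move=> Ox xy; apply: contrapT => nOy.
have [z bz] := segment_meets_boundary Ox nOy.
move=> /(le_trans (bdist_le _ bz)); rewrite enorm_distC => /(lt_le_trans xy).
by rewrite ltxx.
Qed.

Lemma closure_bdist_gt0 x : closure O x -> 0 < bd x -> O x.
Proof.
move=> cx x0; apply: contrapT => nOx.
have := bdist_le x (closure_domain_boundary cx nOx).
by rewrite subrr enorm0 leNgt x0.
Qed.

Lemma closure_domain_compact : compact (closure O).
Proof.
apply: bounded_closed_compact; last exact: closed_closure.
case: domO => _ _ _ _ [M [Mr OM]]; exists M; split => // r Mr' x cx.
have cl : closed [set z : 'rV[R]_n | `|z| <= r].
  rewrite (_ : [set z | _] = [set z | `|0 - z| <= r]); first exact: closed_closed_ball_.
  by apply/seteqP; split => z /=; rewrite sub0r normrN.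
have : closure [set z : 'rV[R]_n | `|z| <= r] x.
  by apply: closureS cx => z Oz; exact: OM.
by move/closure_id: cl => <-.
Qed.

(** The exhaustion of O by compact sets that contains all nearly minimal curves
    between two given points. *)
Lemma bdist_ge_compact (c : R) : compact (closure O `&` [set x | c <= bd x]).
Proof.
apply: subclosed_compact closure_domain_compact _; last by move=> ? [].
apply: closedI; first exact: closed_closure.
move=> x cx; rewrite /= -subr_ge0.
apply/ler_addgt0Pr => e e0.
have [y [cy ye]] := cx _ (near_enorm_lt x e0).
rewrite addrAC subr_ge0 (le_trans cy) // (le_trans (bdist_lip x y)) //.
by rewrite lerD2l ltW.
Qed.

End BoundaryDistance.

(** * Length of curves *)

Section CurveLength.
Context {R : realType} {n : nat}.
Implicit Types (g : R -> 'rV[R]_n) (a b c s t : R) (l : seq R).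

(** Polygonal length by recursion on the list of subdivision points, so that
    concatenation and refinement are proved by induction. *)
Fixpoint chain_length g a l : R :=
  if l is x :: l' then enorm (g x - g a) + chain_length g x l' else 0.

Lemma polygonal_length_chain g a b l :
  polygonal_length g a b l = chain_length g a l.
Proof.
rewrite /polygonal_length /=.
elim: l a => [a|x l IH a] /=; first by rewrite big_nil.
by rewrite big_nat_recl //= IH.
Qed.

Lemma chain_length_ge0 g a l : 0 <= chain_length g a l.
Proof. by elim: l a => //= x l IH a; rewrite addr_ge0 // enorm_ge0. Qed.

Lemma chain_length_cat g a l1 l2 :
  chain_length g a (l1 ++ l2) =
  chain_length g a l1 + chain_length g (last a l1) l2.
Proof. by elim: l1 a => [a|x l1 IH a] /=; rewrite ?add0r // IH addrA. Qed.

Lemma enorm_le_chain_length g a l :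
  enorm (g (last a l) - g a) <= chain_length g a l.
Proof.
elim: l a => [a|x l IH a] /=; first by rewrite subrr enorm0.
by rewrite (le_trans (enorm_dist_triangle (g x) _ _)) // addrC lerD2l IH.
Qed.

Lemma curve_lengthE g a b :
  curve_length g a b =
  ereal_sup [set (chain_length g a l)%:E | l in itv_partition a b].
Proof.
rewrite /curve_length; congr ereal_sup; apply/seteqP.
by split=> _ [l al <-]; exists l => //; rewrite polygonal_length_chain.
Qed.

Lemma curve_length_ub g a b l : itv_partition a b l ->
  ((chain_length g a l)%:E <= curve_length g a b)%E.
Proof. by move=> al; rewrite curve_lengthE; apply: ereal_sup_ubound; exists l. Qed.

Lemma curve_length_le g a b (M : \bar R) :
  (forall l, itv_partition a b l -> ((chain_length g a l)%:E <= M)%E) ->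
  (curve_length g a b <= M)%E.
Proof.
by move=> H; rewrite curve_lengthE; apply: ge_ereal_sup => _ [l al <-]; exact: H.
Qed.

Lemma itv_partition_exists a b : a <= b -> exists l, itv_partition a b l.
Proof.
rewrite le_eqVlt => /predU1P[->|ab]; last by exists [:: b]; exact: itv_partition1.
by exists [::]; split => /=.
Qed.

Lemma enorm_le_curve_length g a b : a <= b ->
  ((enorm (g b - g a))%:E <= curve_length g a b)%E.
Proof.
move=> /itv_partition_exists [l al]; apply: le_trans (curve_length_ub g al).
by case: al => _ /eqP <-; rewrite lee_fin enorm_le_chain_length.
Qed.

Lemma curve_length_ge0 g a b : a <= b -> (0 <= curve_length g a b)%E.
Proof.
move=> /(enorm_le_curve_length g); apply: le_trans.
by rewrite lee_fin enorm_ge0.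
Qed.

Lemma curve_lengthxx g a : curve_length g a a = 0%E.
Proof.
apply/eqP; rewrite eq_le curve_length_ge0 // andbT.
by apply: curve_length_le => l /itv_partitionxx ->.
Qed.

(** Inserting a subdivision point does not decrease the polygonal length, by
    the triangle inequality. *)
Lemma itv_partition_split a b c l : a <= c -> c <= b -> itv_partition a b l ->
  exists l1 l2, [/\ itv_partition a c l1, itv_partition c b l2
    & forall g, chain_length g a l <= chain_length g a l1 + chain_length g c l2].
Proof.
elim: l a => [|x l IH] a ac cb pl.
  exists [::], [::]; move: ac cb; rewrite (itv_partition_nil pl) => ac cb.
  have <- : b = c by apply/eqP; rewrite eq_le ac cb.
  by split => // g /=; rewrite addr0.
have pl' := itv_partition_cons pl.
have ax : a < x by case: pl => /= /andP[].
have [xc|cx] := leP x c.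
  have [l1 [l2 [p1 p2 H]]] := IH _ xc cb pl'.
  exists (x :: l1), l2; split => //.
    by case: p1 => p1 e1; split => //=; rewrite ax.
  by move=> g /=; rewrite -addrA lerD2l.
have px : itv_partition c b (x :: l).
  by case: pl' => p1 e1; split => //=; rewrite cx.
move: ac; rewrite le_eqVlt => /predU1P[<-|ac].
  by exists [::], (x :: l); split => // g /=; rewrite add0r.
exists [:: c], (x :: l); split => //; first exact: itv_partition1.
move=> g /=; rewrite addr0 addrA lerD2r.
by rewrite (le_trans (enorm_dist_triangle (g c) _ _)) // addrC.
Qed.

Lemma curve_lengthD g a b c : a <= c -> c <= b ->
  curve_length g a b = (curve_length g a c + curve_length g c b)%E.
Proof.
move=> ac cb; apply/eqP; rewrite eq_le; apply/andP; split.
  apply: curve_length_le => l /(itv_partition_split ac cb) [l1 [l2 [p1 p2]]].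
  move=> /(_ g); rewrite -lee_fin => /le_trans; apply.
  by rewrite EFinD leeD // curve_length_ub.
have [cb_inf|cb_fin] := eqVneq (curve_length g c b) +oo%E.
  rewrite cb_inf addey; last first.
    by rewrite gt_eqF // (lt_le_trans _ (curve_length_ge0 g ac)) // ltNy0.
  rewrite -cb_inf; apply: curve_length_le => l2 p2.
  have [l1 p1] := itv_partition_exists ac.
  apply: le_trans (curve_length_ub g (itv_partition_cat p1 p2)).
  by rewrite chain_length_cat lee_fin; case: p1 => _ /eqP ->; rewrite lerDr chain_length_ge0.
have {}cb_fin : curve_length g c b \is a fin_num.
  by rewrite ge0_fin_numE ?curve_length_ge0 // ltey.
rewrite -leeBrDr //; apply: curve_length_le => l1 p1.
rewrite leeBrDr // addeC -leeBrDr //; apply: curve_length_le => l2 p2.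
rewrite leeBrDr //.
apply: le_trans (curve_length_ub g (itv_partition_cat p1 p2)).
rewrite chain_length_cat -EFinD lee_fin.
by case: p1 => _ /eqP ->; rewrite addrC.
Qed.

(** Lengths are bounded by the sum of the variations of the coordinates.  This
    and the next bound reduce the continuity of arc length to that of the total
    variation of real functions. *)
Lemma chain_length_variation g a b l :
  chain_length g a l <= \sum_(i < n) variation a b (fun t => g t 0 i) l.
Proof.
rewrite -(polygonal_length_chain g a b) /polygonal_length /variation /=.
rewrite exchange_big /=; apply: ler_sum => k _.
apply: (le_trans (enorm_le_sum _)); apply: ler_sum => i _.
by rewrite !mxE.
Qed.

Lemma variation_chain_length g a b l (i : 'I_n) :
  variation a b (fun t => g t 0 i) l <= chain_length g a l.
Proof.
rewrite -(polygonal_length_chain g a b) /polygonal_length /variation /=.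
by apply: ler_sum => k _; rewrite (le_trans _ (coord_le_enorm _ i)) // !mxE.
Qed.

End CurveLength.

(** * Arc length *)

Section RectifiableCurve.
Context {R : realType} {n : nat} (g : R -> 'rV[R]_n) (a b : R).
Hypothesis rect : rectifiable_curve g a b.
Implicit Types s t u v : R.

Definition arclength t : R := fine (curve_length g a t).

Let ab : a <= b. Proof. by case: rect. Qed.

Lemma sub_curve_length_fin s t : a <= s -> s <= t -> t <= b ->
  curve_length g s t \is a fin_num.
Proof.
move=> as_ st tb; rewrite ge0_fin_numE ?curve_length_ge0 //.
case: rect => _ _; apply: le_lt_trans.
rewrite (@curve_lengthD _ _ g a b s) ?(le_trans st) //.
rewrite (@curve_lengthD _ _ g s b t) //.
apply: (le_trans (y := (curve_length g s t + curve_length g t b)%E)).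
  by rewrite leeDl // curve_length_ge0.
by rewrite leeDr // curve_length_ge0.
Qed.

Lemma arclengthB s t : a <= s -> s <= t -> t <= b ->
  arclength t - arclength s = fine (curve_length g s t).
Proof.
move=> as_ st tb; rewrite /arclength (@curve_lengthD _ _ g a t s) //.
rewrite fineD ?sub_curve_length_fin // ?(le_trans st) //.
by rewrite addrAC subrr add0r.
Qed.

Lemma arclength_start : arclength a = 0.
Proof. by rewrite /arclength curve_lengthxx. Qed.

Lemma arclength_homo s t : a <= s -> s <= t -> t <= b ->
  arclength s <= arclength t.
Proof.
move=> as_ st tb; rewrite -subr_ge0 arclengthB // fine_ge0 //.
exact: curve_length_ge0.
Qed.

Lemma enorm_le_arclength s t : a <= s -> s <= t -> t <= b ->
  enorm (g t - g s) <= arclength t - arclength s.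
Proof.
move=> as_ st tb; rewrite arclengthB // -lee_fin fineK ?sub_curve_length_fin //.
exact: enorm_le_curve_length.
Qed.

Lemma coord_bounded_variation (i : 'I_n) :
  bounded_variation a b (fun t => g t 0 i).
Proof.
exists (arclength b) => _ [l pl <-].
rewrite -lee_fin /arclength fineK ?sub_curve_length_fin //.
by rewrite (le_trans _ (curve_length_ub g pl)) // lee_fin variation_chain_length.
Qed.

Let coordTV (i : 'I_n) t := fine (total_variation a t (fun t => g t 0 i)).

Let coordTV_continuous i : a < b -> {within `[a, b], continuous (coordTV i)}.
Proof.
move=> ltab; apply: total_variation_continuous ltab _ (coord_bounded_variation i).
case: rect => _ cg _ x.
apply: (@continuous_comp (subspace `[a, b]) 'rV[R]_n R g (fun v : 'rV[R]_n => v 0 i) x).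
  exact: cg.
exact: coord_continuous.
Qed.

Lemma arclengthB_le s t : a <= s -> s <= t -> t <= b ->
  arclength t - arclength s <= \sum_(i < n) (coordTV i t - coordTV i s).
Proof.
move=> as_ st tb.
have tvfin i u v : a <= u -> u <= v -> v <= b ->
    total_variation u v (fun t => g t 0 i) \is a fin_num.
  move=> au uv vb; apply/bounded_variationP => //.
  apply: (@bounded_variationl _ _ v b) => //.
  apply: (@bounded_variationr _ a) => //; first exact: le_trans vb.
  exact: coord_bounded_variation.
have tvB i : coordTV i t - coordTV i s =
    fine (total_variation s t (fun t => g t 0 i)).
  rewrite /coordTV (@total_variationD _ a t s) // fineD ?tvfin ?(le_trans st) //.
  by rewrite addrAC subrr add0r.
rewrite arclengthB // -lee_fin fineK ?sub_curve_length_fin //.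
apply: curve_length_le => l pl; rewrite lee_fin.
rewrite (le_trans (chain_length_variation g s t l)) //.
apply: ler_sum => i _; rewrite tvB -lee_fin fineK ?tvfin //.
by apply: ereal_sup_ubound; exists (variation s t (fun t => g t 0 i) l) => //; exists l.
Qed.

(** An increment of arc length is bounded by the increments of the total
    variations of the coordinates, which are continuous. *)
Lemma arclength_continuous : {within `[a, b], continuous arclength}.
Proof.
move: ab; rewrite le_eqVlt => /predU1P[<-|ltab].
  by rewrite set_itv1; exact: continuous_subspace1.
have cS : {within `[a, b], continuous (fun t => \sum_(i < n) coordTV i t)}.
  move=> x; apply: cvg_big => [|i _]; last exact: coordTV_continuous.
  exact: add_continuous.
have key s u : s \in `[a, b] -> u \in `[a, b] -> s <= u ->
    `|arclength u - arclength s| <=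
    `|\sum_(i < n) coordTV i u - \sum_(i < n) coordTV i s|.
  rewrite !in_itv /= => /andP[as_ sb] /andP[au ub] su.
  rewrite ger0_norm ?subr_ge0 ?arclength_homo //.
  by rewrite (le_trans _ (ler_norm _)) // -sumrB arclengthB_le.
apply/subspace_continuousP => x xab; apply/cvgrPdist_lt => e e0.
have /subspace_continuousP /(_ x xab) /cvgrPdist_lt /(_ e e0) := cS.
apply: filter_app; have := withinT `[a, b]%classic (nbhs_filter x).
apply: filterS => t tab; apply: le_lt_trans.
have [tx|xt] := leP t x; first exact: key.
by rewrite distrC [leRHS]distrC key // ltW.
Qed.

Lemma arclength_onto s t v : a <= s -> s <= t -> t <= b ->
  arclength s <= v <= arclength t ->
  exists r, [/\ s <= r, r <= t & arclength r = v].
Proof.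
move=> as_ st tb vst.
have cst : {within `[s, t], continuous arclength}.
  by apply: continuous_subspaceW arclength_continuous; exact: subset_itv.
have [|r rst rv] := IVT st cst (v := v).
  by rewrite min_l ?max_r // arclength_homo.
by move: rst; rewrite in_itv /= => /andP[sr rt]; exists r.
Qed.

(** Parameters with the same arc length bound a piece of curve of length zero,
    so the choice made by [arclength_param] does not matter. *)
Lemma arclength_paramK t : a <= t -> t <= b ->
  arclength_param g a b (arclength t) = g t.
Proof.
move=> at_ tb; rewrite /arclength_param; case: xgetP => [s _|]; last first.
  move=> /(_ t) []; split; first by rewrite in_itv /= at_.
  by rewrite /arclength fineK // sub_curve_length_fin.
move=> [/[!in_itv]/= /andP[as_ sb] /(congr1 fine)]; rewrite /= -/(arclength s) => st.
apply/eqP; rewrite -subr_eq0; apply/eqP/enorm_eq0/eqP.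
rewrite eq_le enorm_ge0 andbT.
have [/enorm_le_arclength le_st|/ltW /enorm_le_arclength le_ts] := leP t s.
  by rewrite (le_trans (le_st _ _)) // st subrr.
by rewrite enorm_distC (le_trans (le_ts _ _)) // st subrr.
Qed.

Lemma arclength_param_lip u v : 0 <= u -> u <= v -> v <= arclength b ->
  enorm (arclength_param g a b v - arclength_param g a b u) <= v - u.
Proof.
move=> u0 uv vb.
have [|s [as_ sb su]] := @arclength_onto a b u (lexx a) ab (lexx b).
  by rewrite arclength_start u0 (le_trans uv).
have [|t [at_ tb tv]] := @arclength_onto a b v (lexx a) ab (lexx b).
  by rewrite arclength_start vb (le_trans u0).
rewrite -su -tv !arclength_paramK //.
have [st|/ltW ts] := leP s t; first exact: enorm_le_arclength.
move: (arclength_homo at_ ts sb); rewrite su tv => vu.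
have uv' : u = v by apply/eqP; rewrite eq_le uv.
rewrite enorm_distC (le_trans (enorm_le_arclength at_ ts sb)) //.
by rewrite su tv uv'.
Qed.

(** This holds for every real u: when no point of the curve has arc length u,
    [arclength_param] takes the value [g a]. *)
Lemma arclength_param_in u : (g @` `[a, b]) (arclength_param g a b u).
Proof.
rewrite /arclength_param; case: xgetP => [s _ [sab _]|_]; first by exists s.
by exists a => //=; rewrite in_itv /= lexx.
Qed.

End RectifiableCurve.

(** * Functions compared up to quadratic errors *)

Section Growth.
Context {R : realType}.
Implicit Types (a b s t u v : R).

(** Cut [a, b] into N equal pieces: the errors add up to C (b - a)^2 / N. *)
Lemma quadratic_increments_le (F : R -> R) (a b C : R) : a <= b ->
  (forall s t, a <= s -> s <= t -> t <= b -> F t - F s <= C * (t - s) ^+ 2) ->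
  F b <= F a.
Proof.
move=> ab H.
have bound N : F b - F a <= C * (b - a) ^+ 2 / N.+1%:R.
  pose x (i : nat) := a + (b - a) * (i%:R / N.+1%:R).
  have x0 : x 0%N = a by rewrite /x mul0r mulr0 addr0.
  have xN : x N.+1 = b by rewrite /x divff // mulr1 subrKC.
  have xlt i j : (i <= j)%N -> x i <= x j.
    move=> ij; rewrite lerD2l ler_wpM2l ?subr_ge0 //.
    by rewrite ler_wpM2r ?invr_ge0 // ler_nat.
  have -> : F b - F a = \sum_(0 <= i < N.+1) (F (x i.+1) - F (x i)).
    by rewrite (telescope_sumr (F \o x)) //= x0 xN.
  have -> : C * (b - a) ^+ 2 / N.+1%:R =
      \sum_(0 <= i < N.+1) C * ((b - a) / N.+1%:R) ^+ 2.
    rewrite sumr_const_nat subn0 -mulr_natr; field.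
    by rewrite ?natr1 ?nat1r pnatr_eq0.
  rewrite !big_nat; apply: ler_sum => i /andP[_ iN].
  have -> : (b - a) / N.+1%:R = x i.+1 - x i.
    rewrite /x -natr1; field.
    by rewrite ?natr1 ?nat1r pnatr_eq0.
  by apply: H; rewrite -?x0 -?xN xlt.
rewrite -subr_le0 leNgt; apply/negP => Fpos.
have := bound (Num.trunc (C * (b - a) ^+ 2 / (F b - F a))).
rewrite ler_pdivlMr // leNgt => /negP; apply.
by rewrite [ltRHS]mulrC -ltr_pdivrMr // truncnS_gt.
Qed.

Lemma expR_sub1_le r : expR r - 1 <= r * expR r :> R.
Proof.
have := expR_ge1Dx (- r).
rewrite -(ler_pM2l (expR_gt0 r)) -expRD subrr expR0; nra.
Qed.

End Growth.

(** * Integrals bounded below by logarithms *)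

Section IntegralBounds.
Context {R : realType} (l : R) (rho : R -> R).
Hypothesis rhoC : {within `[0, l], continuous rho}.
Implicit Types s t u v : R.
Local Notation mu := (@lebesgue_measure R).

Definition primitive (u : R) : R := \int[mu]_(s in `[0, u]) rho s.
Local Notation Psi := primitive.

Lemma primitive0 : Psi 0 = 0.
Proof. by rewrite /Psi set_itv1 Rintegral_set1. Qed.

Let rho_integrable : mu.-integrable `[0, l] (EFin \o rho).
Proof. by apply: continuous_compact_integrable => //; exact: segment_compact. Qed.

Lemma primitiveE : (\int[mu]_(s in `[0%R, l]) (rho s)%:E)%E = (Psi l)%:E.
Proof. by rewrite /Psi /Rintegral fineK // integrable_fin_num. Qed.

Let primitiveB u v : 0 <= u -> u <= v -> v <= l ->
  Psi v - Psi u = \int[mu]_(s in `]u, v]) rho s.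
Proof.
move=> u0 uv vl; rewrite /Psi Rintegral_itvB ?bnd_simp //.
apply: integrableS rho_integrable => //.
by apply: subset_itvl; rewrite bnd_simp.
Qed.

Let measure_ocitv u v : u <= v -> fine (mu `]u, v]) = v - u.
Proof.
rewrite lebesgue_measure_itv /= lte_fin => uv; case: ltP => // vu.
by rewrite /=; apply/eqP; rewrite eq_sym subr_eq0 eq_le uv vu.
Qed.

Let cst_integrable u v (M : R) : mu.-integrable `]u, v] (EFin \o cst M).
Proof.
apply: (@integrableS _ _ _ mu `[u, v]%classic) => //.
  by apply: subset_itvr; rewrite bnd_simp.
apply: continuous_compact_integrable; first exact: segment_compact.
by move=> x; exact: cvg_cst.
Qed.

Let rho_integrable_oc u v : 0 <= u -> v <= l ->
  mu.-integrable `]u, v] (EFin \o rho).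
Proof. by move=> u0 vl; apply: integrableS rho_integrable => //; exact: subset_itv. Qed.

Lemma primitiveB_le u v (M : R) : 0 <= u -> u <= v -> v <= l ->
  (forall s, u <= s -> s <= v -> rho s <= M) -> Psi v - Psi u <= M * (v - u).
Proof.
move=> u0 uv vl H; rewrite primitiveB // -measure_ocitv // -Rintegral_cst //.
apply: le_Rintegral => //; [exact: rho_integrable_oc|exact: cst_integrable|].
by move=> s /=; rewrite in_itv /= => /andP[/ltW us sv]; exact: H.
Qed.

Lemma le_primitiveB u v (M : R) : 0 <= u -> u <= v -> v <= l ->
  (forall s, u <= s -> s <= v -> M <= rho s) -> M * (v - u) <= Psi v - Psi u.
Proof.
move=> u0 uv vl H; rewrite primitiveB // -measure_ocitv // -Rintegral_cst //.
apply: le_Rintegral => //; [exact: cst_integrable|exact: rho_integrable_oc|].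
by move=> s /=; rewrite in_itv /= => /andP[/ltW us sv]; exact: H.
Qed.

Lemma primitive_homo u v : (forall s, 0 <= rho s) ->
  0 <= u -> u <= v -> v <= l -> Psi u <= Psi v.
Proof.
move=> rho0 u0 uv vl; rewrite -subr_ge0.
by have := @le_primitiveB u v 0 u0 uv vl; rewrite mul0r; apply.
Qed.

Lemma primitive_continuous : 0 <= l -> {within `[0, l], continuous Psi}.
Proof. by move=> l0; exact: parameterized_integral_continuous. Qed.

(* By concavity of ln, increments of ln (d + s) are those of a primitive of
   1 / (d + s) up to a quadratic error. *)
Let ln_divB (x y : R) : 0 < x -> 0 < y -> ln y - ln x <= (y - x) / x.
Proof.
move=> x0 y0; rewrite -ln_div ?posrE //.
have -> : y / x = 1 + (y - x) / x by field; rewrite gt_eqF.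
by apply: le_ln1Dx; rewrite ltr_pdivlMr //; lra.
Qed.

Let log_error (x y d r : R) : 0 < d -> d <= x -> d <= y ->
  y = x + r -> r / x - y^-1 * r <= d^-1 ^+ 2 * r ^+ 2.
Proof.
move=> d0 dx dy yx.
have x0 : 0 < x by exact: lt_le_trans dx.
have y0 : 0 < y by exact: lt_le_trans dy.
have -> : r / x - y^-1 * r = (x^-1 * y^-1) * r ^+ 2.
  by have -> : r = y - x; [lra | field; rewrite !gt_eqF].
apply: ler_wpM2r; first exact: sqr_ge0.
by rewrite expr2 ler_pM ?invr_ge0 ?(ltW x0) ?(ltW y0) // lef_pV2 ?posrE.
Qed.

Let expR_of_ln (d r : R) z : 0 < d -> 0 <= r -> ln (d + r) - ln d <= z ->
  r <= d * (expR z - 1).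
Proof.
move=> d0 r0; have dr : 0 < d + r by rewrite ltr_wpDr.
rewrite -ln_div ?posrE // -[_ <= z]ler_expR lnK ?posrE ?divr_gt0 //.
by rewrite ler_pdivrMr //; lra.
Qed.

(** If rho s >= 1 / (d + (s - u)), as for the inverse distance to the boundary
    along a unit speed curve that starts at distance d, then the integral of
    rho from u to v is at least log (1 + (v - u) / d). *)
Lemma expR_primitive_forward (d u v : R) : 0 < d -> 0 <= u -> u <= v -> v <= l ->
  (forall s, u <= s -> s <= v -> (d + (s - u))^-1 <= rho s) ->
  v - u <= d * (expR (Psi v - Psi u) - 1).
Proof.
move=> d0 u0 uv vl H; apply: expR_of_ln; rewrite ?subr_ge0 //.
have := @quadratic_increments_le _ (fun s => ln (d + (s - u)) - Psi s) u v
  (d^-1 ^+ 2) uv.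
rewrite subrr addr0 => step; suff : ln (d + (v - u)) - Psi v <= ln d - Psi u by lra.
apply: step => s t us st tv.
have x0 : 0 < d + (s - u) by lra.
have y0 : 0 < d + (t - u) by lra.
have := ln_divB x0 y0.
have := @log_error (d + (s - u)) (d + (t - u)) d (t - s) d0.
have : (d + (t - u))^-1 * (t - s) <= Psi t - Psi s.
  apply: le_primitiveB; [lra|lra|lra|move=> r sr rt].
  by rewrite (le_trans _ (H r _ _)) ?lef_pV2 ?posrE //; lra.
have -> : d + (t - u) - (d + (s - u)) = t - s by lra.
move=> h1 h2 h3; have := h2 _ _ _; rewrite ?lerDl ?subr_ge0 => /(_ us).
move=> /(_ (le_trans us st)) h4; have := h4 _; lra.
Qed.

(** The same bound when the distance d is known at the end of the curve. *)
Lemma expR_primitive_backward (d u v : R) : 0 < d -> 0 <= u -> u <= v -> v <= l ->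
  (forall s, u <= s -> s <= v -> (d + (v - s))^-1 <= rho s) ->
  v - u <= d * (expR (Psi v - Psi u) - 1).
Proof.
move=> d0 u0 uv vl H; apply: expR_of_ln; rewrite ?subr_ge0 //.
have := @quadratic_increments_le _ (fun s => - ln (d + (v - s)) - Psi s) u v
  (d^-1 ^+ 2) uv.
rewrite subrr addr0 => step.
suff : - ln d - Psi v <= - ln (d + (v - u)) - Psi u by lra.
apply: step => s t us st tv.
have x0 : 0 < d + (v - s) by lra.
have y0 : 0 < d + (v - t) by lra.
have := ln_divB y0 x0.
have := @log_error (d + (v - t)) (d + (v - s)) d (t - s) d0.
have : (d + (v - s))^-1 * (t - s) <= Psi t - Psi s.
  apply: le_primitiveB; [lra|lra|lra|move=> r sr rt].
  by rewrite (le_trans _ (H r _ _)) ?lef_pV2 ?posrE //; lra.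
have -> : d + (v - s) - (d + (v - t)) = t - s by lra.
move=> h1 h2 h3; have := h2 _ _ _; rewrite ?lerDl ?subr_ge0 => /(_ tv).
move=> /(_ (le_trans st tv)) h4; have := h4 _; lra.
Qed.

End IntegralBounds.

(** * Quasihyperbolically Lipschitz curves *)

Section QuasihyperbolicLipschitz.
Context {R : realType} {n : nat} (O : set 'rV[R]_n).
Implicit Types (x y z : 'rV[R]_n) (h g : R -> 'rV[R]_n) (a b s t u v r L : R).
Local Notation bd := (bdist O).

(** The infinitesimal condition |h'| <= d (h), where d is the distance to the
    boundary, in integrated form: d (h t) <= d (h s) exp |t - s| follows, and
    the integral of d (h s) exp (r - s) over s <= r <= t is the right-hand
    side. *)
Definition qh_lipschitz h L : Prop :=
  (forall s, 0 <= s <= L -> O (h s)) /\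
  forall s t, 0 <= s <= L -> 0 <= t <= L ->
    enorm (h t - h s) <= bd (h s) * (expR `|t - s| - 1).

Definition qh_joined x y L : Prop :=
  exists h, [/\ qh_lipschitz h L, h 0 = x & h L = y].

End QuasihyperbolicLipschitz.

Lemma dist_le_of_itv (R : realDomainType) (s t L : R) :
  0 <= s <= L -> 0 <= t <= L -> `|t - s| <= L.
Proof.
move=> /andP[s0 sL] /andP[t0 tL]; rewrite ler_norml; apply/andP; split; lra.
Qed.

(** The error made on a piece of parameter length r when the inverse distance
    to the boundary is replaced by its upper bound there. *)
Lemma expR_second_order (R : realType) (L r : R) : 0 <= r -> r <= L ->
  expR r * (expR r - 1) - r <= 2 * expR (2 * L) * r ^+ 2.
Proof.
move=> r0 rL.
have E_le : expR r ^+ 2 <= expR (2 * L).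
  by rewrite expr2 -expRD ler_expR; lra.
have E1 := expR_sub1_le r.
have E2 : expR r ^+ 2 - 1 <= 2 * r * expR r ^+ 2.
  by rewrite expr2 -expRD (_ : r + r = 2 * r) ?expR_sub1_le //; lra.
have E0 : 0 < expR r by exact: expR_gt0.
move: (expR r) (expR (2 * L)) E_le E1 E2 E0 => E F E_le E1 E2 E0.
apply: (@le_trans _ _ (r * (E ^+ 2 - 1))).
  have : E * (E - 1) <= E * (r * E) by rewrite ler_wpM2l // ltW.
  by rewrite expr2; lra.
apply: (@le_trans _ _ (r * (2 * r * E ^+ 2))); first by rewrite ler_wpM2l.
have : r ^+ 2 * E ^+ 2 <= r ^+ 2 * F by rewrite ler_wpM2l // sqr_ge0.
by rewrite !expr2; lra.
Qed.

(** * Parametrization by quasihyperbolic length *)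

Section CurveToLipschitz.
Context {R : realType} {n : nat} (O : set 'rV[R]_n).
Hypothesis domO : bounded_domain O.
Variables (g : R -> 'rV[R]_n) (a b : R).
Hypotheses (rect : rectifiable_curve g a b) (gO : g @` `[a, b] `<=` O).
Implicit Types (s t u v r : R).
Local Notation bd := (bdist O).

Local Notation l := (arclength g a b).
Local Notation gamma := (arclength_param g a b).
Local Notation rho := (fun s => (bd (gamma s))^-1).
Local Notation Psi := (primitive rho).

Let ab : a <= b. Proof. by case: rect. Qed.

Let l0 : 0 <= l.
Proof. by rewrite -(arclength_start g a) (arclength_homo rect). Qed.

Let gammaO s : O (gamma s).
Proof. by apply: gO; exact: arclength_param_in. Qed.

Let bd_gamma_gt0 s : 0 < bd (gamma s). Proof. exact: bdist_gt0. Qed.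

Let gamma_lip s t : 0 <= s <= l -> 0 <= t <= l ->
  enorm (gamma t - gamma s) <= `|t - s|.
Proof.
move=> /andP[s0 sl] /andP[t0 tl].
have [st|ts] := leP s t.
  by rewrite ger0_norm ?subr_ge0 // arclength_param_lip.
by rewrite ltr0_norm ?subr_lt0 // opprB enorm_distC arclength_param_lip // ltW.
Qed.

(** The distance to the boundary is 1-Lipschitz in the arc length and positive
    along the curve. *)
Lemma inv_bdist_arclength_continuous : {within `[0, l], continuous rho}.
Proof.
move=> x; apply: (@cvgV _ _ (nbhs x)); first by rewrite gt_eqF.
move: x; apply/subspace_continuousP => x /= /[!in_itv] /= xl.
apply/cvgrPdist_lt => e e0; rewrite near_withinE; near=> t => tl.
have xt : `|x - t| < e by near: t; exact: cvgr_dist_lt.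
rewrite (le_lt_trans _ xt) //.
have := gamma_lip xl tl; have := gamma_lip tl xl.
have := bdist_lip domO (gamma x) (gamma t); have := bdist_lip domO (gamma t) (gamma x).
rewrite [`|t - x|]distrC ler_norml => h1 h2 h3 h4; apply/andP; split; lra.
Unshelve. all: by end_near. Qed.

(* Along the curve the distance to the boundary is at most its value at u plus
   |s - u|, so the logarithmic lower bounds apply on both sides of u. *)
Let Psi_expR u v : 0 <= u <= l -> 0 <= v <= l ->
  enorm (gamma v - gamma u) <= bd (gamma u) * (expR `|Psi v - Psi u| - 1).
Proof.
move=> ul vl; rewrite (le_trans (gamma_lip ul vl)) //.
have rho_ge s : 0 <= s <= l -> (bd (gamma u) + `|s - u|)^-1 <= rho s.
  move=> sl; rewrite lef_pV2 ?posrE ?ltr_wpDr //.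
  by rewrite (le_trans (bdist_lip domO (gamma u) _)) // lerD2l gamma_lip.
have rho0 s : 0 <= rho s by rewrite invr_ge0 ltW.
have Psi_homo := primitive_homo inv_bdist_arclength_continuous rho0.
have [u0 ul'] := andP ul; have [v0 vl'] := andP vl.
have [uv|/ltW vu] := leP u v.
  rewrite !ger0_norm ?subr_ge0 ?Psi_homo //.
  apply: (expR_primitive_forward inv_bdist_arclength_continuous) => // s us sv.
  by rewrite -(@ger0_norm _ (s - u)) ?subr_ge0 // rho_ge // (le_trans u0) // (le_trans sv).
rewrite !ler0_norm ?subr_le0 ?opprB ?Psi_homo //.
apply: (expR_primitive_backward inv_bdist_arclength_continuous) => // s vs su.
rewrite -(@ger0_norm _ (u - s)) ?subr_ge0 // distrC rho_ge //.
by rewrite (le_trans v0) // (le_trans su).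
Qed.

(** The required curve is the given one, parametrized by quasihyperbolic
    length: phi is a right inverse of the quasihyperbolic length function
    [primitive rho] of the arc length. *)
Lemma line_integral_joined : exists2 L,
  line_integral (fun z => (bd z)^-1) g a b = L%:E &
  0 <= L /\ qh_joined O (g a) (g b) L.
Proof.
exists (Psi l).
  by rewrite -(primitiveE inv_bdist_arclength_continuous).
have Psi0 : Psi 0 = 0 by exact: primitive0.
have Psil0 : 0 <= Psi l.
  rewrite -Psi0 (primitive_homo inv_bdist_arclength_continuous) // => s.
  by rewrite invr_ge0 ltW.
split=> //.
have inv v : exists u, 0 <= v <= Psi l -> 0 <= u <= l /\ Psi u = v.
  have [vl|nvl] := boolP (0 <= v <= Psi l); last by exists 0.
  have [|u ul uv] := IVT l0 (primitive_continuous inv_bdist_arclength_continuous l0) (v := v).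
    by rewrite Psi0 min_l ?max_r.
  by exists u => _; move: ul; rewrite in_itv.
have [phi phiP] := choice inv.
have gammaPsi u w : 0 <= u <= l -> 0 <= w <= l -> Psi u = Psi w -> gamma u = gamma w.
  move=> ul wl uw; apply/eqP; rewrite -subr_eq0; apply/eqP/enorm_eq0/eqP.
  rewrite eq_le enorm_ge0 andbT (le_trans (Psi_expR wl ul)) //.
  by rewrite uw subrr normr0 expR0 subrr mulr0.
exists (gamma \o phi); split.
- split => [s _|s t sl tl]; first exact: gammaO.
  have [us es] := phiP _ sl; have [ut et] := phiP _ tl.
  by rewrite /= (le_trans (Psi_expR us ut)) // es et.
- have [|u0 e0] := phiP 0; first by rewrite lexx.
  rewrite /= (@gammaPsi _ 0) ?lexx ?Psi0 //.
  by rewrite -(arclength_start g a) arclength_paramK.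
- have [|u0 e0] := phiP (Psi l); first by rewrite lexx andbT.
  rewrite /= (@gammaPsi _ l) ?lexx ?andbT //.
  by rewrite arclength_paramK.
Qed.

End CurveToLipschitz.

(** * Quasihyperbolic length of a Lipschitz curve *)

Section LipschitzToCurve.
Context {R : realType} {n : nat} (O : set 'rV[R]_n).
Hypothesis domO : bounded_domain O.
Variables (h : R -> 'rV[R]_n) (L : R).
Hypotheses (L0 : 0 <= L) (hlip : qh_lipschitz O h L).
Implicit Types (s t u v r : R).
Local Notation bd := (bdist O).

Let hO s : 0 <= s <= L -> O (h s). Proof. by case: hlip => + _; exact. Qed.

Let bd_h_gt0 s : 0 <= s <= L -> 0 < bd (h s).
Proof. by move=> sL; apply: bdist_gt0 => //; exact: hO. Qed.

Lemma qh_lipschitz_bdist s t : 0 <= s <= L -> 0 <= t <= L ->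
  bd (h t) <= bd (h s) * expR `|t - s|.
Proof.
case: hlip => _ H sL tL; have := H _ _ sL tL.
have := bdist_lip domO (h s) (h t); lra.
Qed.

Lemma qh_lipschitz_continuous : {within `[0, L], continuous h}.
Proof.
apply/subspace_continuousP => s /= /[!in_itv] /= sL.
pose C := bd (h s) * expR L.
have C0 : 0 < C by rewrite mulr_gt0 ?expR_gt0 ?bd_h_gt0.
apply/cvgrPdist_lt => e e0; rewrite near_withinE; near=> t => /=.
rewrite in_itv /= => tL; rewrite distrC (le_lt_trans (norm_le_enorm _)) //.
have [_ /(_ _ _ sL tL)] := hlip; move/le_lt_trans; apply.
apply: (@le_lt_trans _ _ (C * `|t - s|)).
  rewrite /C -mulrA ler_wpM2l ?(ltW (bd_h_gt0 sL)) //.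
  rewrite (le_trans (expR_sub1_le _)) // mulrC ler_wpM2r // ler_expR.
  exact: dist_le_of_itv.
rewrite -ltr_pdivlMl // distrC; near: t; apply: cvgr_dist_lt => //.
by rewrite mulr_gt0 // invr_gt0.
Unshelve. all: by end_near. Qed.

(** The bound is a telescoping sum, since the distance to the boundary grows at
    most exponentially along h. *)
Lemma qh_lipschitz_chain_length s l : 0 <= s -> last s l <= L ->
  path <%O s l -> chain_length h s l <= bd (h s) * (expR (last s l - s) - 1).
Proof.
elim: l s => [|t l IH] s s0 /=; first by rewrite subrr expR0 subrr mulr0.
move=> lL /andP[st tl].
have tlast : t <= last t l by exact: (itv_partition_le (conj tl (eqxx _))).
have sL : 0 <= s <= L by rewrite s0 /= (le_trans (ltW st)) // (le_trans tlast).
have tL : 0 <= t <= L by rewrite (le_trans s0 (ltW st)) (le_trans tlast).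
have [t0 _] := andP tL.
have := IH t t0 lL tl; have [_ /(_ _ _ sL tL)] := hlip.
have := qh_lipschitz_bdist sL tL.
rewrite gtr0_norm ?subr_gt0 // => h1 h2 h3.
have -> : last t l - s = (t - s) + (last t l - t) by lra.
rewrite expRD.
have e1 : 1 <= expR (last t l - t) by rewrite -expR0 ler_expR subr_ge0.
move: (expR (last t l - t)) (expR (t - s)) e1 h1 h2 h3 => E F e1 h1 h2 h3.
have : bd (h t) * (E - 1) <= bd (h s) * F * (E - 1) by rewrite ler_wpM2r // subr_ge0.
lra.
Qed.

Lemma qh_lipschitz_length s t : 0 <= s -> s <= t -> t <= L ->
  (curve_length h s t <= (bd (h s) * (expR (t - s) - 1))%:E)%E.
Proof.
move=> s0 st tL; apply: curve_length_le => l [pl /eqP lt]; rewrite lee_fin.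
by rewrite -lt qh_lipschitz_chain_length // lt.
Qed.

Lemma qh_lipschitz_rectifiable : rectifiable_curve h 0 L.
Proof.
split => //; first exact: qh_lipschitz_continuous.
exact: le_lt_trans (qh_lipschitz_length (lexx 0) L0 (lexx L)) (ltry _).
Qed.

Let rect := qh_lipschitz_rectifiable.
Local Notation lam := (arclength h 0).
Local Notation gamma := (arclength_param h 0 L).
Local Notation rho := (fun s => (bd (gamma s))^-1).

(** On a piece of parameter length r that starts at h s, the arc length is at
    most d (exp r - 1) and the density at most exp r / d, where d is the
    distance from h s to the boundary.  The product is r up to a quadratic
    error. *)
Lemma qh_lipschitz_dist : (qh_dist O (h 0) (h L) <= L%:E)%E.
Proof.
have imO : h @` `[0, L] `<=` O.
  by move=> _ [s /= sL <-]; apply: hO; rewrite in_itv in sL.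
have rhoC := inv_bdist_arclength_continuous domO rect imO.
apply: (@le_trans _ _ (line_integral (fun z => (bd z)^-1) h 0 L)).
  by apply: ereal_inf_lbound; exists h, 0, L.
rewrite (_ : line_integral _ _ _ _ = (primitive rho (lam L))%:E); last first.
  by rewrite -(primitiveE rhoC).
rewrite lee_fin.
have step := @quadratic_increments_le _ (fun t => primitive rho (lam t) - t) 0 L
  (2 * expR (2 * L)) L0.
have lam0 : lam 0 = 0 by exact: arclength_start.
rewrite lam0 primitive0 subrr subr_le0 in step.
apply: step => s t s0 st tL.
have sL : 0 <= s <= L by rewrite s0 (le_trans st).
have lam_st : lam t - lam s <= bd (h s) * (expR (t - s) - 1).
  rewrite (arclengthB rect) // -lee_fin fineK ?(sub_curve_length_fin rect) //.
  exact: qh_lipschitz_length.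
have lam_homo u v : 0 <= u -> u <= v -> v <= L -> lam u <= lam v.
  exact: (arclength_homo rect).
have rho_le r : lam s <= r -> r <= lam t -> rho r <= expR (t - s) / bd (h s).
  move=> sr rt; have [|u [su ut <-]] := arclength_onto rect s0 st tL (v := r).
    by rewrite sr.
  have uL : 0 <= u <= L by rewrite (le_trans s0) // (le_trans ut).
  case/andP: (uL) => u0 u1.
  rewrite (arclength_paramK rect) // -[leLHS]mul1r.
  rewrite ler_pdivrMr ?bd_h_gt0 // mulrAC ler_pdivlMr ?bd_h_gt0 // mul1r mulrC.
  rewrite (le_trans (qh_lipschitz_bdist uL sL)) // ler_wpM2l ?(ltW (bd_h_gt0 uL)) //.
  by rewrite ler_expR ler0_norm; lra.
have := primitiveB_le rhoC _ _ _ rho_le.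
have lam_s : 0 <= lam s by rewrite -[leLHS]lam0 lam_homo //; case/andP: sL.
move=> /(_ lam_s (lam_homo _ _ s0 st tL)).
move=> /(_ (lam_homo _ _ (le_trans s0 st) tL (lexx L))) incr.
apply: le_trans (@expR_second_order _ L (t - s) _ _).
- have swap (x y t' s' : R) : x - t' - (y - s') = x - y - (t' - s') by ring.
  rewrite swap lerD2r.
  rewrite (le_trans incr) // -mulrA ler_wpM2l ?expR_ge0 //.
  by rewrite ler_pdivrMl ?bd_h_gt0.
- by rewrite subr_ge0.
- by rewrite lerBlDr (le_trans tL) // lerDl.
Qed.

End LipschitzToCurve.

(** * The quasihyperbolic distance *)

Section QuasihyperbolicDistance.
Context {R : realType} {n : nat} (O : set 'rV[R]_n).
Hypothesis domO : bounded_domain O.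
Implicit Types (x y z : 'rV[R]_n) (h : R -> 'rV[R]_n) (s t L M : R).
Local Notation bd := (bdist O).
Local Notation qh := (qh_dist O).
Local Notation joined := (qh_joined O).

Lemma qh_lipschitz_sub h L s t : qh_lipschitz O h L ->
  0 <= s -> s <= t -> t <= L -> joined (h s) (h t) (t - s).
Proof.
move=> [hO hlip] s0 st tL.
have shift u : 0 <= u <= t - s -> 0 <= s + u <= L.
  by move=> /andP[u0 ut]; apply/andP; split; lra.
exists (fun u => h (s + u)); split; [|by rewrite addr0|by rewrite subrKC].
split => [u /shift /hO //|u v /shift us /shift vs].
have -> : v - u = s + v - (s + u) by lra.
exact: hlip.
Qed.

Lemma qh_joined_le x y L M : 0 <= L -> L <= M -> joined x y L -> joined x y M.
Proof.
move=> L0 LM [h [[hO hlip] h0 hL]].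
have clamp s : 0 <= s <= M -> 0 <= Num.min s L <= L.
  by move=> /andP[s0 _]; rewrite le_min s0 L0 ge_min lexx orbT.
exists (fun s => h (Num.min s L)); split.
- split => [s /clamp /hO //|s t /[dup] sM /clamp sL /[dup] tM /clamp tL].
  apply: (le_trans (hlip _ _ sL tL)); apply: ler_wpM2l; first exact: bdist_ge0.
  rewrite lerD2r ler_expR.
  case: (leP s L) => h1; case: (leP t L) => h2 //.
  - by rewrite !ger0_norm ?subr_ge0 ?(le_trans h1) ?(ltW h2) // lerD2r ltW.
  - by rewrite !ler0_norm ?subr_le0 ?(le_trans h2) ?(ltW h1) // lerN2 lerD2l lerN2 ltW.
  - by rewrite subrr normr0.
- by rewrite min_l.
- by rewrite min_r.
Qed.

Lemma qh_joined_sym x y L : joined x y L -> joined y x L.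
Proof.
move=> [h [[hO hlip] h0 hL]].
have flip s : 0 <= s <= L -> 0 <= L - s <= L.
  by move=> /andP[s0 sL]; apply/andP; split; lra.
exists (fun s => h (L - s)); split; [|by rewrite subr0|by rewrite subrr].
split => [s /flip /hO //|s t /flip sL /flip tL].
by rewrite (le_trans (hlip _ _ sL tL)) // opprB [_ - _ + _]addrC subrKA distrC.
Qed.

(* The bounds compose because exp r (exp q - 1) + (exp r - 1) = exp (r + q) - 1. *)
Let step_trans x y z (r q : R) : 0 <= q ->
  enorm (y - x) <= bd x * (expR r - 1) -> enorm (z - y) <= bd y * (expR q - 1) ->
  enorm (z - x) <= bd x * (expR (r + q) - 1).
Proof.
move=> q0 xy yz; rewrite (le_trans (enorm_dist_triangle y _ _)) //.
have := bdist_lip domO x y; rewrite expRD => lip.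
have q1 : 1 <= expR q by rewrite -expR0 ler_expR.
have : bd y * (expR q - 1) <= bd x * expR r * (expR q - 1).
  by rewrite ler_wpM2r ?subr_ge0 //; lra.
lra.
Qed.

Lemma qh_joined_trans x y z L M : 0 <= L -> 0 <= M ->
  joined x y L -> joined y z M -> joined x z (L + M).
Proof.
move=> L0 M0 [h [[hO hlip] h0 hL]] [k [[kO klip] k0 kM]].
have shift s : s <= L + M -> L <= s -> 0 <= s - L <= M.
  by move=> sLM Ls; apply/andP; split; lra.
have LL : 0 <= L <= L by rewrite L0 lexx.
have MM : 0 <= (0 : R) <= M by rewrite lexx M0.
exists (fun s => if s <= L then h s else k (s - L)); split; last first.
- case: ifPn => [|_]; last by rewrite addrAC subrr add0r.
  rewrite gerDl => M_le0; have M_eq0 : M = 0 by apply/eqP; rewrite eq_le M_le0.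
  by rewrite M_eq0 addr0 hL -k0 -kM M_eq0.
- by rewrite L0.
split => [s /andP[s0 sLM]|s t /andP[s0 sLM] /andP[t0 tLM]].
  case: (leP s L) => sL; first by apply: hO; rewrite s0.
  by apply: kO; apply: shift => //; exact: ltW.
case: (leP s L) => sL; case: (leP t L) => tL.
- by apply: hlip; rewrite ?s0 ?t0.
- have sL' : 0 <= s <= L by rewrite s0.
  have tM := shift _ tLM (ltW tL).
  have := hlip _ _ sL' LL; have := klip _ _ MM tM.
  rewrite hL k0 subr0 !ger0_norm ?subr_ge0 ?(le_trans sL) ?(ltW tL) // => h1 h2.
  have := step_trans _ h2 h1; rewrite subr_ge0 => /(_ (ltW tL)).
  by rewrite [L - s + _]addrC subrKA.
- have tL' : 0 <= t <= L by rewrite t0.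
  have sM := shift _ sLM (ltW sL).
  have := hlip _ _ LL tL'; have := klip _ _ sM MM.
  rewrite hL k0 sub0r normrN [`|t - L|]distrC [`|t - s|]distrC.
  rewrite !ger0_norm ?subr_ge0 ?(le_trans tL) ?(ltW sL) // => h1 h2.
  have := step_trans _ h1 h2; rewrite subr_ge0 => /(_ tL).
  by rewrite subrKA.
- have := klip _ _ (shift _ sLM (ltW sL)) (shift _ tLM (ltW tL)).
  by rewrite opprB addrA subrK.
Qed.

Lemma qh_joined_enorm x y L : 0 <= L -> joined x y L ->
  enorm (y - x) <= bd x * (expR L - 1).
Proof.
move=> L0 [h [[_ hlip] <- <-]].
have := hlip 0 L; rewrite !lexx L0 subr0 ger0_norm //; exact.
Qed.

(** Along the segment the distance to the boundary is at least half its value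
    at x, and the speed of the segment over [0, L] is at most that. *)
Lemma qh_joined_segment x y L : O x -> 0 < L -> L <= 1 ->
  enorm (y - x) <= bd x / 2 * L -> joined x y L.
Proof.
move=> Ox L0 L1 xyL.
have bd0 := bdist_gt0 domO Ox.
pose h (s : R) := x + (s / L) *: (y - x).
have hx s : 0 <= s <= L -> enorm (h s - x) <= bd x / 2.
  move=> /andP[s0 sL]; rewrite /h addrC addKr enormZ ger0_norm ?divr_ge0 ?(ltW L0) //.
  rewrite mulrAC ler_pdivrMr // (le_trans _ xyL) //.
  by rewrite ler_piMl ?enorm_ge0 ?(le_trans sL).
have bdh s : 0 <= s <= L -> bd x / 2 <= bd (h s).
  by move=> /hx; have := bdist_lip domO (h s) x; rewrite enorm_distC; lra.
exists h; split; [split => [s sL|s t sL tL]|by rewrite /h mul0r scale0r addr0|].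
- by apply: (bdist_ball domO Ox); rewrite (le_lt_trans (hx _ sL)) //; lra.
- have -> : h t - h s = ((t - s) / L) *: (y - x).
    by rewrite /h opprD addrACA subrr add0r -scalerBl -mulrBl.
  rewrite enormZ normrM normfV (gtr0_norm L0) mulrAC ler_pdivrMr //.
  apply: (@le_trans _ _ (`|t - s| * (bd x / 2 * L))); first by rewrite ler_wpM2l.
  rewrite mulrCA mulrA ler_pM2r //.
  have := expR_ge1Dx `|t - s|; have := bdh _ sL => h1 h2.
  by apply: ler_pM => //; lra.
- by rewrite /h divff ?gt_eqF // scale1r subrKC.
Qed.

Lemma near_qh_joined x L : O x -> 0 < L -> \forall y \near x, joined x y L.
Proof.
move=> Ox L0; pose M := Num.min L 1.
have M0 : 0 < M by rewrite lt_min L0 ltr01.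
have bd0 := bdist_gt0 domO Ox.
have e0 : 0 < bd x / 2 * M by rewrite mulr_gt0 // divr_gt0.
apply: filterS (near_enorm_lt x e0) => y /ltW xy.
apply: (@qh_joined_le _ _ M); [exact: ltW|by rewrite ge_min lexx|].
by apply: qh_joined_segment => //; rewrite ge_min lexx orbT.
Qed.

(** The points that can be joined to x form an open and closed subset of the
    connected set O. *)
Lemma qh_joined_exists x y : O x -> O y -> exists2 L, 0 <= L & joined x y L.
Proof.
move=> Ox; case: (domO) => _ openO connO _ _.
pose B := [set z | O z /\ exists2 L, 0 <= L & joined x z L].
have near_O z : O z -> \forall w \near z, O w /\ joined z w 1.
  move=> Oz; near=> w; split; near: w; last exact: near_qh_joined.
  by move: openO; rewrite openE; exact.
suff OB : B = O by rewrite -{1}OB => -[].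
apply: connO.
- exists x; split => //; exists 1 => //.
  exact: nbhs_singleton (near_qh_joined Ox ltr01).
- exists B; last by apply/seteqP; split => [z []|z []].
  rewrite openE => z [Oz [L L0 xz]]; rewrite /interior /=.
  apply: filterS (near_O z Oz) => w [Ow zw]; split => //; exists (L + 1).
    by rewrite addr_ge0.
  by apply: qh_joined_trans zw => //; exact: ler01.
- exists (closure B); first exact: closed_closure.
  apply/seteqP; split => z; first by move=> [Oz ?]; split => //; apply: subset_closure; split.
  move=> [Oz /(_ _ (near_O z Oz)) [w [[Ow [L L0 xw]] [_ /qh_joined_sym wz]]]].
  split => //; exists (L + 1); first by rewrite addr_ge0.
  by apply: qh_joined_trans wz => //; exact: ler01.
Unshelve. all: by end_near. Qed.

Lemma qh_dist_ge0 x y : (0 <= qh x y)%E.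
Proof.
apply: le_ereal_inf_tmp => _ [g [a [b [rect gO _ _ ->]]]].
by have [L -> [L0 _]] := line_integral_joined domO rect gO; rewrite lee_fin.
Qed.

Lemma qh_joined_dist x y L : 0 <= L -> joined x y L -> (qh x y <= L%:E)%E.
Proof. by move=> L0 [h [hlip <- <-]]; exact: qh_lipschitz_dist. Qed.

Lemma qh_dist_joined x y L : (qh x y < L%:E)%E -> joined x y L.
Proof.
move=> /ereal_inf_lt [_ [g [a [b [rect gO <- <- ->]]]]].
have [M -> [M0 gab]] := line_integral_joined domO rect gO.
by rewrite lte_fin => /ltW ML; exact: qh_joined_le gab.
Qed.

Lemma qh_dist_fin x y : O x -> O y -> qh x y \is a fin_num.
Proof.
move=> Ox Oy; rewrite ge0_fin_numE ?qh_dist_ge0 //.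
have [L L0 xy] := qh_joined_exists Ox Oy.
exact: le_lt_trans (qh_joined_dist L0 xy) (ltry _).
Qed.

Lemma qh_dist_sym x y : O x -> O y -> qh x y = qh y x.
Proof.
suff le_sym u v : O u -> O v -> (qh u v <= qh v u)%E.
  by move=> Ox Oy; apply/eqP; rewrite eq_le !le_sym.
move=> Ou Ov; rewrite -(fineK (qh_dist_fin Ov Ou)).
apply/lee_addgt0Pr => e e0; rewrite -EFinD.
apply: qh_joined_dist; first by rewrite addr_ge0 ?fine_ge0 ?qh_dist_ge0 // ltW.
apply/qh_joined_sym/qh_dist_joined.
by rewrite EFinD fineK ?qh_dist_fin // lteDl ?qh_dist_fin // lte_fin.
Qed.

(** This makes compact subsets of O bounded for the quasihyperbolic distance. *)
Lemma qh_dist_locally_bounded w z : O w -> O z ->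
  exists M, \forall y \near z, (qh w y <= M%:E)%E.
Proof.
move=> Ow Oz; have [L L0 wz] := qh_joined_exists Ow Oz.
exists (L + 1); apply: filterS (near_qh_joined Oz ltr01) => y zy.
by apply: qh_joined_dist; [rewrite addr_ge0 | exact: qh_joined_trans zy].
Qed.

End QuasihyperbolicDistance.

(** * Existence of geodesics *)

Section Geodesics.
Context {R : realType} {n : nat} (O : set 'rV[R]_n).
Hypothesis domO : bounded_domain O.
Variables x y : 'rV[R]_n.
Hypotheses (Ox : O x) (Oy : O y).
Implicit Types (z : 'rV[R]_n) (h : R -> 'rV[R]_n) (s t L M : R).
Local Notation bd := (bdist O).
Local Notation D := (fine (qh_dist O x y)).

Let D0 : 0 <= D. Proof. exact/fine_ge0/qh_dist_ge0. Qed.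

Let almost_minimal (i : nat) : qh_joined O x y (D + i.+1%:R^-1).
Proof.
apply: qh_dist_joined => //; rewrite EFinD fineK ?qh_dist_fin //.
by rewrite lteDl ?qh_dist_fin // lte_fin invr_gt0.
Qed.

(* The nearly minimal curves h_i have values in a compact set, hence a cluster
   point g for pointwise convergence, and the Lipschitz condition passes to g.
   The curve h_i is parametrized by [0, D + eps_i]; cutting it at D moves its
   end by at most the distance from y to the boundary times exp eps_i - 1. *)
Let almost_minimal_limit : exists g, [/\ qh_lipschitz O g D, g 0 = x & g D = y].
Proof.
have [h hP] := choice almost_minimal.
pose eps (i : nat) : R := i.+1%:R^-1.
have eps0 i : 0 < eps i by rewrite invr_gt0.
have eps1 i : eps i <= 1 by rewrite invf_le1 // ler1n.
pose core := closure O `&` [set z | bd x * expR (- (D + 1)) <= bd z].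
have bdx0 := bdist_gt0 domO Ox.
have core_O z : core z -> O z.
  move=> [cz zx]; apply: (closure_bdist_gt0 domO cz).
  by rewrite (lt_le_trans _ zx) // mulr_gt0 ?expR_gt0.
have core_h i s : 0 <= s <= D -> core (h i s).
  move=> /andP[s0 sD]; have [hlip h0 hD] := hP i.
  have sL : 0 <= s <= D + eps i by rewrite s0 (le_trans sD) // lerDl ltW.
  have oL : 0 <= (0 : R) <= D + eps i by rewrite lexx addr_ge0 // ltW.
  split; first by apply: subset_closure; case: hlip => + _; apply.
  have := qh_lipschitz_bdist domO hlip sL oL; rewrite h0 sub0r normrN ger0_norm //= => xs.
  rewrite -ler_pdivlMr ?expR_gt0 // -expRN opprK (le_trans xs) //.
  by rewrite ler_wpM2l ?bdist_ge0 // ler_expR (le_trans sD) // lerDl ler01.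
(* Tychonoff's theorem is applied to functions on the whole line. *)
pose clamp s := if 0 <= s <= D then s else 0.
have clampD s : 0 <= clamp s <= D.
  by rewrite /clamp; case: ifP => // _; rewrite lexx.
have clamp_id s : 0 <= s <= D -> clamp s = s by rewrite /clamp => ->.
pose H (i : nat) : forall _ : R, 'rV[R]_n := fun s => h i (clamp s).
have tych := @tychonoff R (fun _ => 'rV[R]_n) (fun _ => core)
  (fun _ => @bdist_ge_compact _ _ O domO _).
have FH : (H @ \oo) [set f | forall s, core (f s)].
  by exists 0%N => // i _ s; exact: core_h.
have [g [gcore gcl]] := tych _ _ FH.
have approx s t e N : 0 <= s <= D -> 0 <= t <= D -> 0 < e ->
    exists i, [/\ (N <= i)%N, enorm (h i s - g s) < e & enorm (h i t - g t) < e].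
  move=> sD tD e0.
  have FN : (H @ \oo) [set f | exists2 i, (N <= i)%N & f = H i].
    by exists N => // i /= Ni; exists i.
  have nb r : nbhs g [set f : R -> 'rV[R]_n | enorm (f r - g r) < e].
    exact: (@proj_continuous R (fun _ => 'rV[R]_n) r g _ (near_enorm_lt (g r) e0)).
  have [_ [[i Ni ->] []]] := gcl _ _ FN (filterI (nb s) (nb t)).
  by rewrite /= /H !clamp_id // => ? ?; exists i.
have DD : 0 <= D <= D by rewrite D0 lexx.
have oD : 0 <= (0 : R) <= D by rewrite lexx.
exists g; split.
- split => [s _|s t sD tD]; first exact/core_O/gcore.
  set E := expR `|t - s|; have E1 : 1 <= E by rewrite -expR0 ler_expR.
  apply/ler_addgt0Pr => e e0.
  have E0 : 0 < E + 1 by lra.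
  have [|i [_ hs ht]] := approx s t (e / (E + 1)) 0%N sD tD; first exact: divr_gt0.
  have [[_ hlip] _ _] := hP i.
  have inL r : 0 <= r <= D -> 0 <= r <= D + eps i.
    by move=> /andP[-> rD]; rewrite (le_trans rD) // lerDl ltW.
  have := hlip _ _ (inL _ sD) (inL _ tD); rewrite -/E => hst.
  have := bdist_lip domO (g s) (h i s).
  have := enorm_dist_triangle (h i t) (g t) (g s).
  have := enorm_dist_triangle (h i s) (h i t) (g s).
  rewrite (enorm_distC (g t) (h i t)) => h1 h2 h3.
  have : e = e / (E + 1) * (E + 1) by rewrite divfK ?gt_eqF.
  set d := e / _ in hs ht * => ed.
  have : bd (h i s) * (E - 1) <= (bd (g s) + d) * (E - 1).
    by rewrite ler_wpM2r ?subr_ge0 //; lra.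
  by rewrite ed; lra.
- apply/eqP; rewrite -subr_eq0; apply/eqP/enorm_eq0/eqP.
  rewrite eq_le enorm_ge0 andbT; apply/ler_addgt0Pr => e e0; rewrite add0r.
  have [i [_ + _]] := approx 0 0 e 0%N oD oD e0.
  by have [_ -> _] := hP i; rewrite enorm_distC => /ltW.
- apply/eqP; rewrite -subr_eq0; apply/eqP/enorm_eq0/eqP.
  rewrite eq_le enorm_ge0 andbT; apply/ler_addgt0Pr => e e0; rewrite add0r.
  have e2 : 0 < e / 2 by rewrite divr_gt0.
  have [i [Ni + _]] := approx D D (e / 2) (Num.trunc (bd y * expR 1 / (e / 2))) DD DD e2.
  have [[_ hlip] _ hy] := hP i.
  have := hlip (D + eps i) D.
  rewrite hy lerDl (ltW (eps0 i)) lexx D0 addr_ge0 ?(ltW (eps0 i)) //.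
  move=> /(_ isT isT); rewrite opprD addNKr normrN gtr0_norm // => hD hg.
  have : bd y * (expR (eps i) - 1) <= e / 2.
    have := expR_sub1_le (eps i).
    have : eps i * expR (eps i) <= eps i * expR 1.
      by rewrite ler_pM2l // ler_expR.
    move=> h1 h2; apply: (@le_trans _ _ (bd y * (eps i * expR 1))).
      by rewrite ler_wpM2l ?bdist_ge0 //; lra.
    rewrite mulrCA mulrC ler_pdivrMr // -ler_pdivrMl // mulrC ltW //.
    by rewrite (lt_le_trans (truncnS_gt _)) // ler_nat.
  have := enorm_dist_triangle (h i D) (g D) y.
  rewrite (enorm_distC (g D) (h i D)); lra.
Qed.

(** A Lipschitz curve whose length is the distance D between its ends is a
    geodesic: if two of its points were closer than their parameters, then
    joining the outer pieces to a short cut would connect the ends with length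
    less than D. *)
Lemma qh_geodesic_exists :
  exists g, [/\ qh_geodesic O g 0 D, g 0 = x & g D = y].
Proof.
have [g [glip g0 gD]] := almost_minimal_limit.
have gO s : 0 <= s <= D -> O (g s) by case: glip => + _; exact.
exists g; split => //; split => //.
  by move=> _ [s /= sD <-]; apply: gO; rewrite in_itv in sD.
have key s t : 0 <= s -> s <= t -> t <= D -> qh_dist O (g s) (g t) = (t - s)%:E.
  move=> s0 st tD.
  have Os : O (g s) by apply: gO; rewrite s0 (le_trans st).
  have Ot : O (g t) by apply: gO; rewrite (le_trans s0 st).
  apply/eqP; rewrite eq_le; apply/andP; split.
    apply: qh_joined_dist => //; first by rewrite subr_ge0.
    exact: qh_lipschitz_sub glip s0 st tD.
  rewrite -(fineK (qh_dist_fin domO Os Ot)); set K := fine _.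
  have K0 : 0 <= K by exact/fine_ge0/qh_dist_ge0.
  rewrite lee_fin; apply/ler_addgt0Pr => e e0.
  have : qh_joined O (g s) (g t) (K + e).
    apply: qh_dist_joined => //; rewrite EFinD fineK ?qh_dist_fin //.
    by rewrite lteDl ?qh_dist_fin // lte_fin.
  have := qh_lipschitz_sub glip (lexx 0) s0 (le_trans st tD).
  have := qh_lipschitz_sub glip (le_trans s0 st) tD (lexx D).
  rewrite g0 gD subr0 => ty xs st'.
  have Ke : 0 <= K + e by rewrite addr_ge0 // ltW.
  have tD0 : 0 <= D - t by rewrite subr_ge0.
  have sKe : 0 <= s + (K + e) by rewrite addr_ge0.
  have := qh_joined_trans domO sKe tD0 (qh_joined_trans domO s0 Ke xs st') ty.
  move=> /(qh_joined_dist domO (addr_ge0 sKe tD0)).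
  rewrite -{1}(fineK (qh_dist_fin domO Ox Oy)) lee_fin; lra.
move=> s t /[!in_itv] /= /andP[s0 sD] /andP[t0 tD].
have [st|/ltW ts] := leP s t; first by rewrite key // distrC ger0_norm ?subr_ge0.
rewrite qh_dist_sym ?key ?ger0_norm ?subr_ge0 //; apply: gO; first by rewrite s0.
by rewrite t0.
Qed.

End Geodesics.

(** * Extension of isometries to the boundary *)

Lemma enorm_cvg (R : realType) (n : nat) (u : nat -> 'rV[R]_n) p :
  (forall k, enorm (u k - p) < k.+1%:R^-1) -> u @ \oo --> p.
Proof.
move=> up; apply/cvgrPdist_lt => e e0; exists (Num.trunc e^-1) => // k /= ek.
rewrite distrC (le_lt_trans (norm_le_enorm _)) // (lt_le_trans (up k)) //.
by rewrite invf_ple ?posrE // (le_trans (ltW (truncnS_gt _))) // ler_nat.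
Qed.

(** Quasihyperbolic distances are bounded near every point of the domain. *)
Lemma qh_dist_escape (R : realType) (n : nat) (O : set 'rV[R]_n) w
    (u : nat -> 'rV[R]_n) z :
  bounded_domain O -> O w -> (fun k => qh_dist O w (u k)) @ \oo --> +oo%E ->
  cluster (u @ \oo) z -> ~ O z.
Proof.
move=> domO Ow uoo uz Oz; have [M zM] := qh_dist_locally_bounded domO Ow Oz.
have farM : (u @ \oo) [set y | (M%:E < qh_dist O w y)%E].
  by move/cvgeyPgt : uoo => /(_ M).
by have [y [/lt_le_trans H /H]] := uz _ _ farM zM; rewrite ltxx.
Qed.

Lemma qh_geodesic_isometry (R : realType) (n : nat) (O O' : set 'rV[R]_n) f g
    (a b : R) :
  qh_isometry O O' f -> qh_geodesic O g a b -> qh_geodesic O' (f \o g) a b.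
Proof.
move=> [fO fd] [ab gO gd]; split => //.
  by move=> _ [s sab <-]; apply: fO; exists (g s) => //; apply: gO; exists s.
by move=> s t sab tab; rewrite /= fd ?gd //; apply: gO; [exists s|exists t].
Qed.

Section Extension.
Context {R : realType} {n : nat} (O O' : set 'rV[R]_n).
Hypotheses (hO : qh_well_behaved O) (hO' : qh_visibility_domain O').
Variable f : 'rV[R]_n -> 'rV[R]_n.
Hypothesis hf : qh_isometry O O' f.
Implicit Types (x y p q xi eta : 'rV[R]_n).

Let domO : bounded_domain O. Proof. by case: hO. Qed.
Let domO' : bounded_domain O'. Proof. by case: hO'. Qed.
Let fO x : O x -> O' (f x). Proof. by move=> Ox; apply: hf.1; exists x. Qed.

(** Geodesics from x_k to y_k escape to infinity in O, hence so do their images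
    in O'; visibility would make the images meet a fixed compact set if xi and
    eta were distinct. *)
Lemma no_two_boundary_limits p xi eta (x y : nat -> 'rV[R]_n) :
  boundary O p -> (forall k, O (x k)) -> (forall k, O (y k)) ->
  x @ \oo --> p -> y @ \oo --> p ->
  f \o x @ \oo --> xi -> f \o y @ \oo --> eta -> xi = eta.
Proof.
move=> bp xO yO xp yp fx fy; apply: contrapT => xi_eta.
have [g gP] := choice (fun k => qh_geodesic_exists domO (xO k) (yO k)).
pose D k := fine (qh_dist O (x k) (y k)).
have D0 k : 0 <= D k by exact/fine_ge0/qh_dist_ge0.
have [_ /(_ x y p (fun=> 0) D g xO yO bp xp yp gP)] := hO.
move=> [x0 Ox0 far].
have gO k s : 0 <= s <= D k -> O (g k s).
  by move=> sD; case: (gP k) => -[_ + _] _ _; apply; exists s => //=; rewrite in_itv.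
have on_geodesic_far (s : nat -> R) : (\forall k \near \oo, 0 <= s k <= D k) ->
    (fun k => qh_dist O' (f x0) (f (g k (s k)))) @ \oo --> +oo%E.
  move=> sD; apply/cvgeyPge => M; move/cvgeyPge : far => /(_ M).
  apply: filterS2 sD => k skD /le_trans; apply.
  rewrite hf.2 //; last exact: gO.
  by apply: ereal_inf_lbound; exists (g k (s k)) => //; exists (s k) => //=; rewrite in_itv.
(* The ends of the geodesics are on them, hence they escape too. *)
have boundary_limit (u : nat -> 'rV[R]_n) (s : nat -> R) z :
    (forall k, 0 <= s k <= D k) -> (forall k, g k (s k) = u k) ->
    f \o u @ \oo --> z -> boundary O' z.
  move=> sD gu fu; apply: closure_domain_boundary.
    apply: (closed_cvg (closure O') (@closed_closure _ O') _ z fu).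
    by apply: nearW => k; apply: subset_closure; apply: fO; rewrite -gu; exact: gO.
  apply: (@qh_dist_escape _ _ _ (f x0) (f \o u)) => //; first exact: fO.
    rewrite (_ : (fun k => _) = (fun k => qh_dist O' (f x0) (f (g k (s k))))).
      by apply: on_geodesic_far; apply: nearW.
    by apply/funext => k; rewrite gu.
  by move=> P Q FP /fu FQ; exact: (filter_ex (filterI FP FQ)).
have bxi : boundary O' xi.
  apply: (boundary_limit x (fun=> 0)) => // k; first by rewrite lexx D0.
  by case: (gP k).
have beta : boundary O' eta.
  apply: (boundary_limit y D) => // k; first by rewrite D0 lexx.
  by case: (gP k).
have [_ /(_ xi eta bxi beta xi_eta) [U [V [K [xiU etaV _ [cK KO'] vis]]]]] := hO'.
have hit : \forall k \near \oo, exists s, 0 <= s <= D k /\ K (f (g k s)).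
  near=> k; have [gk gk0 gkD] := gP k.
  have [||z [[s /= sD <-] Kz]] := vis (D k) (f \o g k) (qh_geodesic_isometry hf gk).
  - by rewrite /= gk0; near: k; exact: fx.
  - by rewrite /= gkD; near: k; exact: fy.
  by exists s; split => //; rewrite in_itv in sD.
have [s sP] : exists s : nat -> R, \forall k \near \oo,
    0 <= s k <= D k /\ K (f (g k (s k))).
  have /choice [s sP] : forall k, exists s,
      (exists s, 0 <= s <= D k /\ K (f (g k s))) -> 0 <= s <= D k /\ K (f (g k s)).
    move=> k; have [[s sP]|nh] := pselect (exists s, 0 <= s <= D k /\ K (f (g k s))).
      by exists s.
    by exists 0.
  by exists s; apply: filterS hit => k; exact: sP.
have inK : ((fun k => f (g k (s k))) @ \oo) K by apply: filterS sP => k [].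
have [z [Kz zcl]] := cK _ _ inK.
apply: (@qh_dist_escape _ _ _ (f x0) _ z domO' _ _ zcl) => //; first exact: fO.
  by apply: on_geodesic_far; apply: filterS sP => k [].
exact: KO'.
Unshelve. all: by end_near. Qed.

Lemma qh_isometry_continuous x : O x -> f @ nbhs x --> f x.
Proof.
move=> Ox; apply/cvgrPdist_le => e e0.
have b0 := bdist_gt0 domO' (fO Ox).
(* M is chosen so that d (exp M - 1) = e, with d the distance from f x to the
   boundary of O'. *)
pose M := ln (1 + e / bdist O' (f x)).
have M0 : 0 < M by rewrite ln_gt0 // ltrDl divr_gt0.
have M2 : 0 < M / 2 by rewrite divr_gt0.
near=> y.
have Oy : O y by near: y; case: domO => _ + _ _ _; rewrite openE; exact.
have xy : qh_joined O x y (M / 2) by near: y; exact: near_qh_joined.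
have : qh_joined O' (f x) (f y) M.
  apply: qh_dist_joined => //; rewrite hf.2 //.
  by rewrite (le_lt_trans (qh_joined_dist domO (ltW M2) xy)) // lte_fin; lra.
move=> /(qh_joined_enorm (ltW M0)).
rewrite lnK ?posrE ?addr_gt0 ?divr_gt0 // addrAC subrr add0r.
rewrite mulrC divfK ?gt_eqF //; apply: le_trans.
by rewrite distrC norm_le_enorm.
Unshelve. all: by end_near. Qed.

Let cluster_sequence p xi :
  closure O p -> cluster (f @ within O (nbhs p)) xi ->
  exists x : nat -> 'rV[R]_n, [/\ forall k, O (x k), x @ \oo --> p &
    f \o x @ \oo --> xi].
Proof.
move=> cp xicl.
have H k : exists x, [/\ O x, enorm (x - p) < k.+1%:R^-1 &
    enorm (f x - xi) < k.+1%:R^-1].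
  have k0 : 0 < k.+1%:R^-1 :> R by rewrite invr_gt0.
  have Fp : (f @ within O (nbhs p))
      [set f x | x in [set x | O x /\ enorm (x - p) < k.+1%:R^-1]].
    by apply: filterS (near_enorm_lt p k0) => x xp Ox; exists x.
  by have [_ [[x [Ox xp] <-] fx]] := xicl _ _ Fp (near_enorm_lt xi k0); exists x.
have [x xP] := choice H; exists x; split.
- by move=> k; case: (xP k).
- by apply: enorm_cvg => k; case: (xP k).
- by apply: enorm_cvg => k; case: (xP k).
Qed.

(** At a boundary point the values of f cluster somewhere in the compact set
    [closure O'].  Cluster points are limits of f along sequences, so
    [no_two_boundary_limits] leaves only one. *)
Lemma qh_isometry_limit p : closure O p -> exists2 l, closure O' l &
  f @ within O (nbhs p) --> l /\ (O p -> l = f p).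
Proof.
move=> cp.
have [Op|nOp] := pselect (O p).
  exists (f p); first exact/subset_closure/fO.
  split=> //; apply: cvg_trans (qh_isometry_continuous Op).
  by apply: cvg_app; exact: cvg_within.
have bp := closure_domain_boundary cp nOp.
have PF : ProperFilter (f @ within O (nbhs p)).
  by apply: fmap_proper_filter; exact: within_nbhs_proper.
have FO' : (f @ within O (nbhs p)) O' by apply: nearW => x; exact: fO.
have FcO' : (f @ within O (nbhs p)) (closure O').
  by apply: filterS FO'; exact: subset_closure.
have [xi [cxi xicl]] := closure_domain_compact domO' PF FcO'.
exists xi => //; split => //.
case: (domO') => _ _ _ _ [M [Mr OM]].
(* A compact neighborhood of xi that contains all values of f. *)
pose V := closed_ball_ Num.norm (0 : 'rV[R]_n) (Num.max (M + 1) (`|xi| + 1)).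
have cV : compact V.
  apply: bounded_closed_compact; last exact: closed_closed_ball_.
  exists (Num.max (M + 1) (`|xi| + 1)); split; first exact: num_real.
  by move=> r Mr' v; rewrite /V /closed_ball_ /= sub0r normrN => /le_trans; apply; exact: ltW.
apply: (compact_cluster_set1 _ cV) => //.
- apply: filterS (nbhsx_ballx xi 1 ltr01) => v; rewrite -ball_normE /ball_ /= => vxi.
  rewrite /V /closed_ball_ /= sub0r normrN le_max; apply/orP; right.
  by have := ler_normB xi (xi - v); rewrite opprB subrKC; lra.
- apply: filterS FO' => v /OM vM; rewrite /V /closed_ball_ /= sub0r normrN.
  by rewrite le_max vM ?ltrDl.
apply/seteqP; split => [eta etacl|_ ->] //=.
have [x [xO xp fx]] := cluster_sequence cp etacl.
have [y [yO yp fy]] := cluster_sequence cp xicl.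
exact: no_two_boundary_limits bp xO yO xp yp fx fy.
Qed.

End Extension.

Theorem theorem2p9 (R : realType) (n : nat) (O O' : set 'rV[R]_n)
    (hO : qh_well_behaved O) (hO' : qh_visibility_domain O')
    (f : 'rV[R]_n -> 'rV[R]_n) (hf : qh_isometry O O' f) :
  exists F : 'rV[R]_n -> 'rV[R]_n,
    [/\ {within closure O, continuous F},
        F @` closure O `<=` closure O'
      & forall x, O x -> F x = f x].
Proof.
have /choice [F FP] : forall p, exists l, closure O p -> closure O' l /\
    (f @ within O (nbhs p) --> l /\ (O p -> l = f p)).
  move=> p; have [cp|ncp] := pselect (closure O p); last by exists 0.
  by have [l cl lP] := qh_isometry_limit hO hO' hf cp; exists l.
exists F; split.
- apply/subspace_continuousP => p cp; apply/cvgrPdist_le => e e0.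
  have [_ [/cvgrPdist_le /(_ e e0) + _]] := FP p cp.
  rewrite near_withinE => /nbhs_interior; rewrite near_withinE.
  apply: filterS => q; rewrite /interior /= => near_q cq.
  have [_ [fq _]] := FP q cq.
  have PF := within_nbhs_proper cq.
  apply/ler_addgt0Pr => r r0; rewrite /=.
  have : \forall x \near within O (nbhs q),
      `|F p - f x| <= e /\ `|F q - f x| <= r.
    near=> x; split; near: x; last by move/cvgrPdist_le : fq; exact.
    by rewrite near_withinE.
  move=> /filter_ex [x [h1 h2]].
  by rewrite (le_trans (ler_distD (f x) _ _)) // lerD // distrC.
- by move=> _ [p cp <-]; case: (FP p cp).
- by move=> x Ox; have [_ [_ ->]] := FP x (subset_closure Ox).
Unshelve. all: by end_near. Qed.
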